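(* Let $V$ be a complex vector space of dimension $2n$ with a symplectic form $\omega$. If $X\subset\mathbb{P}(V)=\mathbb{P}^{2n-1}$ is a smooth irreducible legendrian variety generated by quadrics, then $X$ is a homogeneous space (i.e. an algebraic group acts transitively on $X$).
   Context: A linear subspace $W\subset V$ is Lagrangian if it is a maximal subspace with $\omega|_W\equiv 0$ (so $\dim W=n$). For a projective variety $X\subset\mathbb{P}(V)$ let $\hat X\subset V$ be the affine cone over $X$ and $\hat X_0$ the set of smooth points of $\hat X$ other than $0$. $X$ is legendrian if $T_x\hat X_0\subset V$ is Lagrangian for every $x\in\hat X_0$. $X$ is generated by quadrics if its homogeneous ideal $\mathcal{I}(X)\subset\mathbb{C}[V]$ is generated by its degree 2 part. *)

(* Defs.v *)
From mathcomp Require Import all_boot all_order all_algebra.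
From mathcomp Require Import boolp classical_sets reals complex mpoly.

Set Implicit Arguments.
Unset Strict Implicit.
Unset Printing Implicit Defensive.

Import Order.TTheory GRing.Theory Num.Theory.
Local Open Scope classical_set_scope.
Local Open Scope ring_scope.

(* [closed] is the family of closed subsets of
   a topology on [T]; the Zariski topologies of V and of P(V) are given below. *)
Section ClosedSets.
Variables (T : Type) (closed : set (set T)).

Definition irreducible (Z : set T) : Prop :=
  Z !=set0 /\
  forall A B, closed A -> closed B -> Z `<=` A `|` B -> Z `<=` A \/ Z `<=` B.

(* Z 0 < Z 1 < ... < Z d, all irreducible, closed, inside Y and through x. *)
Definition irreducible_chain (Y : set T) (x : T) (d : nat) (Z : nat -> set T) :
    Prop :=
  (forall i, (i <= d)%N ->
     [/\ closed (Z i), irreducible (Z i), Z i `<=` Y & Z i x]) /\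
  (forall i, (i < d)%N -> Z i `<=` Z i.+1 /\ Z i <> Z i.+1).

(* The local dimension of Y at x (the Krull dimension of the local ring) is d. *)
Definition has_dim_at (Y : set T) (x : T) (d : nat) : Prop :=
  (exists Z, irreducible_chain Y x d Z) /\
  (forall e Z, irreducible_chain Y x e Z -> (e <= d)%N).

End ClosedSets.

Section Affine.
Variables (R : realType) (V : vectType R[i]).

(* The coordinate ring C[V], through the coordinates of a fixed basis of V. *)
Definition polyfun := {mpoly R[i][\dim {:V}]}.

Definition crd (v : V) (i : 'I_(\dim {:V})) : R[i] := coord (vbasis {:V}) i v.

Definition peval (p : polyfun) (v : V) : R[i] := p.@[crd v].

(* The differential of p at x, applied to v. *)
Definition pdiff (p : polyfun) (x v : V) : R[i] :=
  \sum_i (p^`M(i)).@[crd x] * crd v i.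

Definition zariski_closed (Z : set V) : Prop :=
  exists S : set polyfun, Z = [set v | forall p, S p -> peval p v = 0].

Definition vanishing_ideal (Y : set V) : set polyfun :=
  [set p | forall v, Y v -> peval p v = 0].

Definition tangent_dir (Y : set V) (x : V) : set V :=
  [set v | forall p, vanishing_ideal Y p -> pdiff p x v = 0].

(* The Zariski tangent space T_x Y as a subspace of V; see [tangent_spaceP]. *)
Definition tangent_space (Y : set V) (x : V) : {vspace V} :=
  xget 0%VS [set W : {vspace V} | forall v, v \in W <-> tangent_dir Y x v].

Lemma pdiffD p x u v : pdiff p x (u + v) = pdiff p x u + pdiff p x v.
Proof.
rewrite /pdiff -big_split; apply: eq_bigr => i _ /=.
by rewrite /crd linearD mulrDr.
Qed.

Lemma pdiffZ p x a v : pdiff p x (a *: v) = a * pdiff p x v.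
Proof.
rewrite /pdiff mulr_sumr; apply: eq_bigr => i _.
by rewrite /crd linearZ /= mulrCA.
Qed.

Lemma tangent_spaceP (Y : set V) (x v : V) :
  v \in tangent_space Y x <-> tangent_dir Y x v.
Proof.
suff [W hW] : exists W : {vspace V}, forall v, v \in W <-> tangent_dir Y x v.
  by move: v; apply: (@xgetPex _ 0%VS
    [set W : {vspace V} | forall v, v \in W <-> tangent_dir Y x v]); exists W.
pose P d := `[< exists2 W : {vspace V}, \dim W = d &
  forall v, v \in W -> tangent_dir Y x v >].
have exP : exists d, P d.
  exists 0%N; apply/asboolP; exists 0%VS; rewrite ?dimv0 // => u.
  rewrite memv0 => /eqP-> p _.
  by have := pdiffZ p x 0 0; rewrite scale0r mul0r.
have ubP d : P d -> (d <= \dim {:V})%N.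
  by move=> /asboolP[W <- _]; apply: dimvS; apply: subvf.
case: (ex_maxnP exP ubP) => d /asboolP[W dW hW] maxd.
exists W => u; split=> [/hW //|hu].
have /maxd : P (\dim (W + <[u]>)).
  apply/asboolP; exists (W + <[u]>)%VS => // w.
  move=> /memv_addP[w1 /hW h1 [w2 /vlineP[a ->] ->]] p Ip.
  by rewrite pdiffD pdiffZ (h1 p Ip) (hu p Ip) mulr0 addr0.
rewrite -dW => le_d.
have /eqP -> : W == (W + <[u]>)%VS by rewrite eqEdim addvSl le_d.
by rewrite -[u in u \in _]add0r memv_add ?mem0v ?memv_line.
Qed.

Definition smooth_point (Y : set V) (x : V) : Prop :=
  Y x /\ has_dim_at zariski_closed Y x (\dim (tangent_space Y x)).

Definition ideal_generated (S : set polyfun) : set polyfun :=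
  [set p | exists (k : nat) (a q : 'I_k -> polyfun),
     (forall i, S (q i)) /\ p = \sum_i a i * q i].

Section Lagrangian.
Variable omega : V -> V -> R[i].

Definition isotropic (W : {vspace V}) : Prop :=
  forall u v, u \in W -> v \in W -> omega u v = 0.

Definition lagrangian (W : {vspace V}) : Prop :=
  isotropic W /\
  forall W' : {vspace V}, isotropic W' -> (W <= W')%VS -> W' = W.

End Lagrangian.

End Affine.

(* The projective space P(V) of lines in V. *)
Definition proj (R : realType) (V : vectType R[i]) : Type :=
  {L : {vspace V} | \dim L == 1%N}.

Section Projective.
Variables (R : realType) (V : vectType R[i]).

Definition proj_closed (Z : set (proj V)) : Prop :=
  exists S : set (polyfun V),
    (forall p, S p -> exists d, p \is d.-homog) /\
    Z = [set L : proj V | forall p, S p -> forall v, v \in val L -> peval p v = 0].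

(* A subset of P(V) is a quasi-projective variety iff it is locally closed. *)
Definition proj_locally_closed (Z : set (proj V)) : Prop :=
  exists A B, [/\ proj_closed A, proj_closed B & Z = A `\` B].

Definition affine_cone (X : set (proj V)) : set V :=
  [set v | exists2 L, X L & v \in val L].

(* The homogeneous polynomials in [vanishing_ideal (affine_cone X)] are those
   vanishing on X, and they generate it since the cone is stable by scaling. *)
Definition homogeneous_ideal (X : set (proj V)) : set (polyfun V) :=
  vanishing_ideal (affine_cone X).

Definition generated_by_quadrics (X : set (proj V)) : Prop :=
  homogeneous_ideal X `<=`
  ideal_generated [set q | homogeneous_ideal X q /\ q \is 2.-homog].

(* The smooth points of the affine cone, other than 0. *)
Definition cone_smooth (X : set (proj V)) : set V :=
  [set x | smooth_point (affine_cone X) x /\ x <> 0].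

(* X is smooth iff its affine cone is smooth away from the vertex: the cone
   minus 0 is locally the product of X with C^*. *)
Definition smooth_variety (X : set (proj V)) : Prop :=
  affine_cone X `\ 0 `<=` cone_smooth X.

Definition legendrian (omega : V -> V -> R[i]) (X : set (proj V)) : Prop :=
  forall x, cone_smooth X x ->
    lagrangian omega (tangent_space (affine_cone X) x).

End Projective.

Section Regular.
Variables (R : realType).
Implicit Types (W : vectType R[i]).

Definition polynomial_map W1 W2 (F : W1 -> W2) : Prop :=
  forall i, exists p : polyfun W1, forall v, crd (F v) i = peval p v.

(* Morphisms of quasi-projective varieties X1 -> P(W2): near every point, f is
   given by homogeneous polynomials of the same degree, not all zero at that
   point. The formula F may be required to hold on all of X1 (where F is not 0):
   multiply it by a form vanishing outside the neighbourhood. *)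
Definition regular_map W1 W2 (X1 : set (proj W1)) (f : proj W1 -> proj W2) :
    Prop :=
  forall a, X1 a -> exists (F : W1 -> W2) (d : nat),
    [/\ polynomial_map F,
        forall s u, F (s *: u) = s ^+ d *: F u,
        exists2 u, u \in val a & F u <> 0 &
        forall a', X1 a' -> forall u, u \in val a' -> F u \in val (f a')].

(* The same for X1 * X2 -> P(W3), with bihomogeneous polynomials. *)
Definition regular_map2 W1 W2 W3 (X1 : set (proj W1)) (X2 : set (proj W2))
    (f : proj W1 -> proj W2 -> proj W3) : Prop :=
  forall a b, X1 a -> X2 b -> exists (F : W1 * W2 -> W3) (d e : nat),
    [/\ polynomial_map F,
        forall s t u v, F (s *: u, t *: v) = (s ^+ d * t ^+ e) *: F (u, v),
        exists u v, [/\ u \in val a, v \in val b & F (u, v) <> 0] &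
        forall a' b', X1 a' -> X2 b' ->
          forall u v, u \in val a' -> v \in val b' -> F (u, v) \in val (f a' b')].

(* An algebraic group: a quasi-projective variety with a group structure whose
   operations are morphisms. The operations are functions on the ambient P(W),
   of which only the restriction to the variety matters. *)
Record algebraic_group := AlgebraicGroup {
  ag_space : vectType R[i];
  ag_set : set (proj ag_space);
  ag_one : proj ag_space;
  ag_mul : proj ag_space -> proj ag_space -> proj ag_space;
  ag_inv : proj ag_space -> proj ag_space;
  ag_variety : proj_locally_closed ag_set;
  ag_one_in : ag_set ag_one;
  ag_mul_in : forall g h, ag_set g -> ag_set h -> ag_set (ag_mul g h);
  ag_inv_in : forall g, ag_set g -> ag_set (ag_inv g);
  ag_mulA : forall g h k, ag_set g -> ag_set h -> ag_set k ->
    ag_mul g (ag_mul h k) = ag_mul (ag_mul g h) k;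
  ag_mul1g : forall g, ag_set g -> ag_mul ag_one g = g;
  ag_mulVg : forall g, ag_set g -> ag_mul (ag_inv g) g = ag_one;
  ag_mul_regular : regular_map2 ag_set ag_set ag_mul;
  ag_inv_regular : regular_map ag_set ag_inv
}.

Definition algebraic_action (G : algebraic_group) W (X : set (proj W))
    (act : proj (ag_space G) -> proj W -> proj W) : Prop :=
  [/\ forall g x, ag_set g -> X x -> X (act g x),
      forall x, X x -> act (ag_one G) x = x,
      forall g h x, ag_set g -> ag_set h -> X x ->
        act (ag_mul g h) x = act g (act h x) &
      regular_map2 (@ag_set G) X act].

Definition homogeneous_space W (X : set (proj W)) : Prop :=
  exists (G : algebraic_group) (act : proj (ag_space G) -> proj W -> proj W),
    algebraic_action X act /\
    forall x y, X x -> X y -> exists2 g, ag_set g & act g x = y.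

End Regular.

(* Main.v *)
Require Import Defs.
From mathcomp Require Import all_boot all_order all_algebra.
From mathcomp Require Import closed_field.
From mathcomp Require Import boolp classical_sets reals complex mpoly.
From mathcomp Require Import sesquilinear.
From mathcomp Require Import ring lra.

Set Implicit Arguments.
Unset Strict Implicit.
Unset Printing Implicit Defensive.

Import Order.TTheory GRing.Theory Num.Theory.
Local Open Scope ring_scope.

(** Choose coordinates on V, let K be the affine cone of X and I its ideal, and
    let U be the space of quadratic forms that vanish on K. Since quadrics
    generate I, K is the zero set of U. The group is the image in P(M_m), with
    m = dim V, of the invertible matrices that map U to itself; it is
    quasi-projective because this is a system of quadratic equations
    ([stab_group]), and it acts on X ([stab_homogeneous]). The point is that
    these matrices act transitively on the nonzero vectors of K.

    Infinitesimally, this is what the legendrian condition says. The symplectic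
    form turns a quadratic form q into a linear vector field y |-> yA, its
    hamiltonian field. If q vanishes on K then dq vanishes on the tangent space
    T_y of K at y, so yA is orthogonal to T_y, hence lies in T_y, which is
    Lagrangian ([hamiltonian_tangent]). So A differentiates I into I, and in
    particular U into U. Conversely, if v is tangent to K at x, then
    omega(v, -) vanishes on T_x, so it is the differential at x of an element
    of I, and therefore of some q in U because U generates I; the hamiltonian
    field of q takes the value v at x ([tangent_hamiltonian]).

    The fields integrate to the group: the exponential series of tA, for small
    real t, preserves U. Hence a polynomial that vanishes on an orbit has zero
    derivative along yA at every point y of this orbit
    ([tangent_of_stabilizer]), so that the ideal J of the orbit of x is stable
    under the hamiltonian fields, which span T_x at x.

    Let M be the ideal of polynomials that vanish at x. A suitable combination
    D of the fields, with coefficients in M, is an Euler field: it acts on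
    M^k / M^(k+1) modulo I as multiplication by k. It maps J into MJ, so if J
    lies in M^k + I then kJ lies in M^(k+1) + I; by induction J lies in M^k + I
    for all k ([stable_sub_ideal_pow]). Krull's intersection theorem, proved from
    Hilbert's basis theorem, and the primality of I give J = I: every orbit of a
    nonzero vector is Zariski dense in K ([orbit_dense]).

    Finally an orbit is the image of a constructible set under a polynomial
    map, so it is constructible by quantifier elimination, and a dense
    constructible subset of the irreducible set K contains a nonempty open
    subset of K. Two such open subsets meet, so any two orbits coincide
    ([dense_definable_meet], [orbit_transitive]). *)

(** * Noetherian rings *)

Lemma mpoly_ring_ind n (A : comNzRingType) (P : {mpoly A[n]} -> Prop) :
    (forall c, P c%:MP) -> (forall i, P 'X_i) ->
    (forall p q, P p -> P q -> P (p + q)) ->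
    (forall p q, P p -> P q -> P (p * q)) ->
  forall p, P p.
Proof.
move=> PC PX PD PM p; rewrite (mpolyE p).
apply: (big_ind P) => [||m _]; [by rewrite -(mpolyC0 n A) | exact: PD |].
rewrite -mul_mpolyC mpolyXE_id; apply: (PM) => //.
apply: (big_ind P) => [||i _]; [by rewrite -(mpolyC1 n A) | exact: PM |].
elim: (m i) => [|k IH]; first by rewrite expr0 -(mpolyC1 n A).
by rewrite exprS; apply: PM.
Qed.

Section Noetherian.

Definition ideal_pred (A : comNzRingType) (P : A -> Prop) : Prop :=
  [/\ P 0, forall a b, P a -> P b -> P (a + b) & forall c a, P a -> P (c * a)].

Lemma ideal_predN (A : comNzRingType) (P : A -> Prop) a :
  ideal_pred P -> P a -> P (- a).
Proof. by case=> _ _ PM Pa; rewrite -mulN1r; apply: PM. Qed.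

Lemma ideal_predB (A : comNzRingType) (P : A -> Prop) a b :
  ideal_pred P -> P a -> P b -> P (a - b).
Proof.
by move=> iP Pa Pb; have [_ PD _] := iP; apply: PD => //; apply: ideal_predN.
Qed.

Lemma ideal_pred_sum (A : comNzRingType) (P : A -> Prop) (J : Type) (r : seq J)
    (Q : pred J) (F : J -> A) :
  ideal_pred P -> (forall i, Q i -> P (F i)) -> P (\sum_(i <- r | Q i) F i).
Proof. by case=> P0 PD _ PF; apply: (big_ind P). Qed.

(** The conclusion says that P is the ideal generated by s, with the generated
    ideal expressed as the intersection of the ideals Q that contain s. *)
Definition noetherian (A : comNzRingType) : Prop :=
  forall P : A -> Prop, ideal_pred P ->
    exists s : seq A, (forall x, x \in s -> P x) /\
      forall Q, ideal_pred Q -> (forall x, x \in s -> Q x) ->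
        forall a, P a -> Q a.

Lemma noetherian_field (F : fieldType) : noetherian F.
Proof.
move=> P [P0 PD PM].
have [[x Px xN0]|noP] := pselect (exists2 x, P x & x != 0).
  exists [:: x]; split=> [y|Q [Q0 QD QM] Qs a Pa].
    by rewrite inE => /eqP->.
  rewrite -[a](divfK xN0); apply: QM; apply: Qs; exact: mem_head.
exists [::]; split=> // Q [Q0 _ _] _ a Pa.
by have [->//|aN0] := eqVneq a 0; case: noP; exists a.
Qed.

Lemma noetherian_surj (A B : comNzRingType) (phi : {rmorphism A -> B}) :
  (forall b, exists a, phi a = b) -> noetherian A -> noetherian B.
Proof.
move=> phi_surj noethA P [P0 PD PM].
have pre Q : ideal_pred Q -> ideal_pred (fun a => Q (phi a)).
  case=> Q0 QD QM; split=> [|a b|c a].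
  - by rewrite rmorph0.
  - by rewrite rmorphD; apply: QD.
  - by rewrite rmorphM; apply: QM.
have [|s [sP sgen]] := noethA (fun a => P (phi a)); first exact: pre.
exists (map phi s); split=> [_ /mapP[x xs ->]|Q iQ Qs b Pb].
  exact: sP.
have [a ab] := phi_surj b; rewrite -ab in Pb *.
by apply: (sgen (fun a => Q (phi a)) (pre Q iQ)) => // x xs; apply/Qs/map_f.
Qed.

Lemma size_sub_coef (A : comNzRingType) n (f g : {poly A}) :
  (size f <= n.+1)%N -> (size g <= n.+1)%N -> f`_n = g`_n ->
  (size (f - g)%R <= n)%N.
Proof.
move=> sf sg fg; apply/leq_sizeP => j; rewrite leq_eqVlt => /predU1P[<-|ltnj].
  by rewrite coefB fg subrr.
by rewrite coefB !nth_default ?subrr // (leq_trans _ ltnj).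
Qed.

Lemma ideal_coefs (A : comNzRingType) n (P : {poly A} -> Prop) :
  ideal_pred P ->
  ideal_pred (fun a => exists f, [/\ P f, (size f <= n.+1)%N & f`_n = a]).
Proof.
case=> P0 PD PM; split=> [|a b [f [Pf sf <-]] [g [Pg sg <-]]|c a [f [Pf sf <-]]].
- by exists 0; rewrite coef0 size_poly0.
- exists (f + g); rewrite coefD; split=> //; first exact: PD.
  by rewrite (leq_trans (size_polyD _ _)) // geq_max sf sg.
- exists (c%:P * f); rewrite coefCM; split=> //; first exact: PM.
  by rewrite mul_polyC (leq_trans (size_scale_leq _ _)).
Qed.

(** Finite choice: generators of an ideal of leading coefficients are lifted to
    polynomials by this lemma. *)
Lemma lift_seq (S T : eqType) (P : T -> Prop) (h : T -> S) (s : seq S) :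
    (forall x, x \in s -> exists2 y, P y & h y = x) ->
  exists r : seq T, (forall y, y \in r -> P y) /\ map h r = s.
Proof.
elim: s => [|x s IH] hs; first by exists [::].
have [|r [rP rs]] := IH; first by move=> y ys; apply: hs; rewrite inE ys orbT.
have [y Py yx] := hs x (mem_head _ _).
exists (y :: r); split=> [z|]; last by rewrite /= yx rs.
by rewrite inE => /predU1P[->|/rP].
Qed.

(** Hilbert's basis theorem. The leading coefficients of the elements of P form
    an ideal of A, generated by the coefficients in degree N of finitely many
    elements of P of degree at most N; multiplying these by powers of the
    variable lowers the degree of any element of P until it is below N. In
    degree below N, the coefficients in each fixed degree are treated in the
    same way. *)
Lemma noetherian_poly (A : comNzRingType) : noetherian A -> noetherian {poly A}.
Proof.
move=> noethA P iP; have [P0 PD PM] := iP.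
(* Generators for the elements of P of size at most n. *)
have trunc n : exists G : seq {poly A}, (forall f, f \in G -> P f) /\
    forall Q, ideal_pred Q -> (forall f, f \in G -> Q f) ->
      forall f, P f -> (size f <= n)%N -> Q f.
  elim: n => [|n [G [GP Ggen]]].
    exists [::]; split=> // Q [Q0 _ _] _ f _.
    by rewrite leqn0 size_poly_eq0 => /eqP->.
  have [s [sL sgen]] := noethA _ (ideal_coefs n iP).
  have [|r [rP rs]] := @lift_seq _ _
      (fun f : {poly A} => P f /\ (size f <= n.+1)%N) (fun f => f`_n) s.
    by move=> x /sL[f [? ? ?]]; exists f.
  exists (G ++ r); split=> [f|Q iQ QG f Pf sf].
    by rewrite mem_cat => /orP[/GP//|/rP[]].
  have iPQ : ideal_pred (fun f => P f /\ Q f).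
    have [Q0 QD QM] := iQ; split=> // [a b [? ?] [? ?]|c a [? ?]].
      by split; [apply: PD | apply: QD].
    by split; [apply: PM | apply: QM].
  have [||g [[Pg Qg] sg gf]] := sgen _ (ideal_coefs n iPQ) _ f`_n.
  - move=> x; rewrite -rs => /mapP[g gr ->]; exists g.
    by have [? ?] := rP _ gr; do !split=> //; apply: QG; rewrite mem_cat gr orbT.
  - by exists f.
  rewrite -(subrK g f); have [_ QD _] := iQ; apply: QD => //.
  apply: (Ggen Q iQ) => [h hG||]; first by apply: QG; rewrite mem_cat hG.
    exact: ideal_predB.
  exact: size_sub_coef.
pose L a := exists n, exists f, [/\ P f, (size f <= n.+1)%N & f`_n = a].
have shift n m (f : {poly A}) : (n <= m)%N -> (size f <= n.+1)%N ->
    (size ('X^(m - n) * f)%R <= m.+1)%N /\ ('X^(m - n) * f)`_m = f`_n.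
  move=> nm sf; split; last first.
    by rewrite coefXnM ltnNge leq_subr /= subKn.
  apply: (leq_trans (size_polyMleq _ _)); rewrite size_polyXn /=.
  by rewrite -(subnK nm) -addnS addnK leq_add2l.
have [|s [sL sgen]] := noethA L.
  split=> [|a b [n [f [Pf sf fa]]] [m [g [Pg sg gb]]]|c a [n La]].
  - by exists 0%N, 0; rewrite size_poly0 coef0.
  - exists (maxn n m).
    have [_ iD _] := ideal_coefs (maxn n m) iP; apply: iD.
      have [szf cof] := shift n _ f (leq_maxl n m) sf.
      by exists ('X^(maxn n m - n) * f); rewrite cof; split=> //; apply: PM.
    have [szg cog] := shift m _ g (leq_maxr n m) sg.
    by exists ('X^(maxn n m - m) * g); rewrite cog; split=> //; apply: PM.
  - by exists n; have [_ _ iM] := ideal_coefs n iP; apply: iM.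
(* A common degree N for the chosen lifts, reached by multiplying by 'X^k. *)
have [N sN] : exists N, forall x, x \in s ->
    exists f, [/\ P f, (size f <= N.+1)%N & f`_N = x].
  elim: (s) (sL) => [|x r IH] rL; first by exists 0%N.
  have [|N rN] := IH; first by move=> y yr; apply: rL; rewrite inE yr orbT.
  have [n [f [Pf sf fx]]] := rL x (mem_head _ _).
  exists (maxn N n) => y; rewrite inE => /predU1P[->|/rN[g [Pg sg gy]]].
    have [szf cof] := shift n _ f (leq_maxr N n) sf.
    by exists ('X^(maxn N n - n) * f); rewrite cof; split=> //; apply: PM.
  have [szg cog] := shift N _ g (leq_maxl N n) sg.
  by exists ('X^(maxn N n - N) * g); rewrite cog; split=> //; apply: PM.
have [r [rP rs]] := @lift_seq _ _
    (fun f : {poly A} => P f /\ (size f <= N.+1)%N) (fun f => f`_N) s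
    (fun x xs => let: ex_intro f (And3 a b c) := sN x xs in
                 ex_intro2 _ _ f (conj a b) c).
have [G [GP Ggen]] := trunc N.
exists (G ++ r); split=> [f|Q iQ QG f].
  by rewrite mem_cat => /orP[/GP//|/rP[]].
have [n] := ubnP (size f); elim: n f => // n IH f sf Pf.
have [sfN|ltNs] := leqP (size f) N.
  by apply: (Ggen Q iQ) => // h hG; apply: QG; rewrite mem_cat hG.
have [M fM] : exists M, size f = M.+1 by case: (size f) ltNs => // M; exists M.
have NM : (N <= M)%N by rewrite -ltnS -fM.
have iPQ : ideal_pred (fun f => P f /\ Q f).
  have [Q0 QD QM] := iQ; split=> // [a b [? ?] [? ?]|c a [? ?]].
    by split; [apply: PD | apply: QD].
  by split; [apply: PM | apply: QM].
have [||g [[Pg Qg] sg gf]] := sgen _ (ideal_coefs M iPQ) _ f`_M.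
- move=> x; rewrite -rs => /mapP[g gr ->].
  have [Pg sg] := rP _ gr; have [? ?] := shift N _ g NM sg.
  have Qg : Q g by apply: QG; rewrite mem_cat gr orbT.
  exists ('X^(M - N) * g); split=> //; split; first exact: PM.
  by have [_ _ QM] := iQ; apply: QM.
- by exists M, f; rewrite fM.
rewrite -(subrK g f); have [_ QD _] := iQ; apply: QD => //.
apply: IH; last exact: ideal_predB.
rewrite -ltnS (leq_ltn_trans _ sf) // fM ltnS.
by apply: size_sub_coef; rewrite ?fM.
Qed.

(** The variable of index n is adjoined last: {mpoly A[n.+1]} is a quotient of
    {poly {mpoly A[n]}}. *)
Lemma noetherian_mpoly (A : comNzRingType) n :
  noetherian A -> noetherian {mpoly A[n]}.
Proof.
move=> noethA; elim: n => [|n IH].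
  apply: (noetherian_surj (phi := @mpolyC 0 A)) noethA => p.
  by exists p@_0%MM; rewrite [RHS]nvar0_mpolyC.
pose phi := horner_eval ('X_ord_max : {mpoly A[n.+1]}) \o map_poly (@mwiden n A).
apply: (noetherian_surj (phi := phi)) (noetherian_poly IH).
apply: mpoly_ring_ind => [c|i|p q [a <-] [b <-]|p q [a <-] [b <-]].
- by exists c%:MP%:P; rewrite /phi/= map_polyC /= mwidenC /horner_eval hornerC.
- have [lt_in|] := ltnP i n.
    exists ('X_(Ordinal lt_in))%:P.
    rewrite /phi/= map_polyC /= /horner_eval hornerC mwidenX mnmwiden1.
    by congr 'X_[U_(_)]; apply: val_inj.
  move=> le_ni; exists 'X; rewrite /phi/= map_polyX /horner_eval hornerX.
  congr 'X_[U_(_)]; apply/val_inj => /=; apply/eqP.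
  by rewrite eqn_leq le_ni -ltnS ltn_ord.
- by exists (a + b); rewrite rmorphD.
- by exists (a * b); rewrite rmorphM.
Qed.

End Noetherian.

(** * Powers of an ideal and Krull's intersection theorem *)

Lemma pihomogM n (A : comNzRingType) (d e : nat) (c q : {mpoly A[n]}) :
  (e <= d)%N -> q \is e.-homog ->
  pihomog mdeg d (c * q) = pihomog mdeg (d - e) c * q.
Proof.
move=> le_ed hq.
elim/mpolyind: c => [|a m p _ _ IH]; first by rewrite mul0r !pihomog0 mul0r.
rewrite mulrDl !pihomogD IH mulrDl -scalerAl !linearZ /= -scalerAl.
congr (_ *: _ + _).
have hXq : 'X_[m] * q \is (mdeg m + e)%N.-homog by apply: dhomogM; rewrite ?dhomogX.
rewrite pihomogX; case: eqP => [md|/eqP md].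
  by rewrite pihomog_dE //; rewrite md subnK in hXq.
rewrite mul0r; apply: pihomog_ne0 hXq.
by rewrite -(eqn_add2r e) subnK in md.
Qed.

Section IdealPowers.
Variables (S : comNzRingType) (m : nat) (t : 'I_m -> S).

(** The k-th power of the ideal generated by the t i. *)
Fixpoint ideal_pow (k : nat) (f : S) : Prop :=
  if k is k'.+1 then exists2 g : 'I_m -> S,
    forall i, ideal_pow k' (g i) & f = \sum_i t i * g i
  else True.

Lemma ideal_pow_ideal k : ideal_pred (ideal_pow k).
Proof.
elim: k => [|k [I0 ID IM]]; first by split.
split=> [|a b [g gk ->] [h hk ->]|c a [g gk ->]].
- by exists (fun=> 0) => //; rewrite big1 // => i _; rewrite mulr0.
- exists (fun i => g i + h i) => [i|]; first exact: ID (gk i) (hk i).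
  by rewrite -big_split; apply: eq_bigr => i _; rewrite /= mulrDr.
- exists (fun i => c * g i) => [i|]; first exact: IM (gk i).
  by rewrite mulr_sumr; apply: eq_bigr => i _; rewrite mulrCA.
Qed.

Lemma ideal_pow_gen k i f : ideal_pow k f -> ideal_pow k.+1 (t i * f).
Proof.
move=> fk; exists (fun j => if j == i then f else 0) => [j|].
  by case: ifP => // _; case: (ideal_pow_ideal k).
by rewrite (bigD1 i) //= eqxx big1 ?addr0 // => j /negPf->; rewrite mulr0.
Qed.

Lemma ideal_powM k l f g : ideal_pow k f -> ideal_pow l g -> ideal_pow (k + l) (f * g).
Proof.
elim: k f => [|k IH] f; first by move=> _ gl; case: (ideal_pow_ideal l) => _ _; apply.
case=> h hk -> gl; rewrite mulr_suml; apply: ideal_pred_sum => [|i _].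
  exact: ideal_pow_ideal.
by rewrite -mulrA; apply: ideal_pow_gen; apply: IH (hk i) gl.
Qed.

Lemma ideal_powS k f : ideal_pow k.+1 f -> ideal_pow k f.
Proof.
case=> g gk ->; apply: ideal_pred_sum => [|i _]; first exact: ideal_pow_ideal.
by case: (ideal_pow_ideal k) => _ _; apply; apply: gk.
Qed.

Lemma ideal_powW k l f : (k <= l)%N -> ideal_pow l f -> ideal_pow k f.
Proof.
by move=> /subnKC <-; elim: (l - k)%N => [|n IH]; rewrite ?addn0 // addnS => /ideal_powS.
Qed.

(** Forms in new variables, evaluated at t, keep track of the exponent k: they are
    what makes the powers of the ideal accessible to the basis theorem. *)
Lemma ideal_pow_homogP k f :
  ideal_pow k f <-> exists2 P : {mpoly S[m]}, P \is k.-homog & P.@[t] = f.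
Proof.
split; last first.
  case=> P hP <-; rewrite mevalE; apply: ideal_pred_sum => [|a _].
    exact: ideal_pow_ideal.
  have /dhomogP hP' := hP.
  have [aP|/memN_msupp_eq0->] := boolP (a \in msupp P); last first.
    by rewrite mul0r; case: (ideal_pow_ideal k).
  case: (ideal_pow_ideal k) => _ _; apply.
  have <- : (\sum_i a i)%N = k by rewrite -mdegE; apply: hP'.
  apply: (big_ind2 ideal_pow) => // [d p e q hp hq|i _]; first exact: ideal_powM hp hq.
  elim: (a i) => [|d IH] //; rewrite exprS; exact: ideal_pow_gen.
elim: k f => [|k IH] f.
  exists f%:MP; rewrite ?mevalC // dhomogE msuppC.
  by case: ifP => //= _; rewrite mdeg0.
case=> g gk ->.
have /choice[P hP] : forall i, exists P : {mpoly S[m]},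
    P \is k.-homog /\ P.@[t] = g i.
  by move=> i; have [P ? ?] := IH _ (gk i); exists P.
exists (\sum_i 'X_i * P i).
  apply: rpred_sum => i _; rewrite -add1n; apply: dhomogM; last by case: (hP i).
  by rewrite dhomogX /= mdeg1.
by rewrite raddf_sum; apply: eq_bigr => i _; rewrite /= mevalM mevalXU (hP i).2.
Qed.

(** Modulo I, f is the value at t of a form P k of every degree k, and the ideal
    generated by the P k is finitely generated. So some P N is a combination of
    the P i with i < N, with coefficients that may be taken homogeneous of
    degree N - i > 0. At t this reads f = c f modulo I, where c is in the ideal
    generated by t. *)
Lemma krull_intersection (I : S -> Prop) (f : S) :
    noetherian S -> ideal_pred I ->
    (forall k, exists2 g, ideal_pow k g & I (f - g)) ->
  exists2 c, ideal_pow 1 c & I ((1 - c) * f).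
Proof.
move=> noethS iI fk; have [I0 ID IM] := iI.
have /choice[P hP] : forall k, exists P : {mpoly S[m]},
    P \is k.-homog /\ I (f - P.@[t]).
  move=> k; have [g /ideal_pow_homogP[P hP <-] fP] := fk k; by exists P.
pose comb N q := exists c : nat -> {mpoly S[m]}, q = \sum_(i < N) c i * P i.
have icomb N : ideal_pred (comb N).
  split=> [|a b [c ->] [d ->]|e a [c ->]].
  - by exists (fun=> 0); rewrite big1 // => i _; rewrite mul0r.
  - exists (fun i => c i + d i); rewrite -big_split.
    by apply: eq_bigr => i _; rewrite /= mulrDl.
  - exists (fun i => e * c i); rewrite mulr_sumr.
    by apply: eq_bigr => i _; rewrite mulrA.
have combS N M q : (N <= M)%N -> comb N q -> comb M q.
  move=> NM [c ->]; exists (fun i => if (i < N)%N then c i else 0).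
  rewrite (big_ord_widen M (fun i => c i * P i) NM) big_mkcond.
  by apply: eq_bigr => i _; case: ifP; rewrite ?mul0r.
have combP N i : (i < N)%N -> comb N (P i).
  move=> iN; exists (fun j => (j == i)%:R).
  rewrite (bigD1 (Ordinal iN)) //= eqxx mul1r big1 ?addr0 // => j.
  by rewrite -val_eqE /= => /negPf->; rewrite mul0r.
have [|s [sN sgen]] := @noetherian_mpoly S m noethS (fun q => exists N, comb N q).
  split=> [|a b [N aN] [M bM]|c a [N aN]].
  - by exists 0%N; case: (icomb 0%N).
  - exists (maxn N M); have [_ cD _] := icomb (maxn N M).
    apply: cD; first by apply: combS aN; apply: leq_maxl.
    by apply: combS bM; apply: leq_maxr.
  - by exists N; have [_ _ cM] := icomb N; apply: cM.
have [N sNN] : exists N, forall q, q \in s -> comb N q.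
  elim: (s) (sN) => [|q r IH] rN; first by exists 0%N.
  have [|N rNN] := IH; first by move=> y yr; apply: rN; rewrite inE yr orbT.
  have [M qM] := rN q (mem_head _ _); exists (maxn N M) => y.
  rewrite inE => /predU1P[->|/rNN yN]; first by apply: combS qM; apply: leq_maxr.
  by apply: combS yN; apply: leq_maxl.
have [c cP] := sgen _ (icomb N) sNN (P N) (ex_intro _ N.+1 (combP _ _ (ltnSn N))).
have {}cP : P N = \sum_(i < N) pihomog mdeg (N - i) (c i) * P i.
  rewrite -[LHS](pihomog_dE (hP N).1) cP raddf_sum; apply: eq_bigr => i _.
  by rewrite /= (pihomogM _ _ (hP i).1) // ltnW.
exists (\sum_(i < N) (pihomog mdeg (N - i) (c i)).@[t]).
  apply: ideal_pred_sum => [|i _]; first exact: ideal_pow_ideal.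
  apply: (@ideal_powW _ (N - i)); first by rewrite subn_gt0.
  by apply/ideal_pow_homogP; exists (pihomog mdeg (N - i) (c i)); rewrite ?pihomogP.
have -> : (1 - \sum_(i < N) (pihomog mdeg (N - i) (c i)).@[t]) * f =
    f - (P N).@[t] -
    \sum_(i < N) (pihomog mdeg (N - i) (c i)).@[t] * (f - (P i).@[t]).
  have -> : (P N).@[t] =
      \sum_(i < N) (pihomog mdeg (N - i) (c i)).@[t] * (P i).@[t].
    by rewrite {1}cP raddf_sum; apply: eq_bigr => i _; rewrite /= mevalM.
  rewrite mulrBl mul1r mulr_suml -addrA -opprD -big_split.
  congr (_ - _); apply: eq_bigr => i _ /=; ring.
apply: ideal_predB => //; first by case: (hP N).
by apply: ideal_pred_sum => // i _; apply: IM; case: (hP i).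
Qed.

End IdealPowers.

(** * Differentials and second order Taylor expansion *)

(** The value on v of the differential of p at y. *)
Definition mdiff (F : comNzRingType) m (p : {mpoly F[m]}) (y v : 'rV[F]_m) : F :=
  \sum_i (p^`M(i)).@[y 0] * v 0 i.

Section Mdiff.
Variables (F : comNzRingType) (m : nat).
Implicit Types (p q : {mpoly F[m]}) (y v : 'rV[F]_m).

Lemma mdiffC c y v : mdiff c%:MP y v = 0.
Proof. by rewrite /mdiff big1 // => i _; rewrite mderivC meval0 mul0r. Qed.

Lemma mderivXi (i j : 'I_m) : ('X_j : {mpoly F[m]})^`M(i) = (j == i)%:R.
Proof.
rewrite mderivX mnm1E; case: eqP => [->|_]; last by rewrite scale0r.
by rewrite -{1}[U_(i)%MM]add0m addmK mpolyX0 scale1r.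
Qed.

Lemma mdiffX i y v : mdiff 'X_i y v = v 0 i.
Proof.
rewrite /mdiff (bigD1 i) //= mderivXi eqxx meval1 mul1r big1 ?addr0 // => j.
by rewrite mderivXi eq_sym => /negPf->; rewrite meval0 mul0r.
Qed.

Lemma mdiffD p q y v : mdiff (p + q) y v = mdiff p y v + mdiff q y v.
Proof.
by rewrite /mdiff -big_split; apply: eq_bigr => i _ /=; rewrite mderivD mevalD mulrDl.
Qed.

Lemma mdiffM p q y v :
  mdiff (p * q) y v = mdiff p y v * q.@[y 0] + p.@[y 0] * mdiff q y v.
Proof.
rewrite /mdiff mulr_suml mulr_sumr -big_split; apply: eq_bigr => i _ /=.
by rewrite mderivM mevalD !mevalM; ring.
Qed.

Lemma mdiffDr p y u v : mdiff p y (u + v) = mdiff p y u + mdiff p y v.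
Proof. by rewrite /mdiff -big_split; apply: eq_bigr => i _ /=; rewrite mxE mulrDr. Qed.

Lemma mdiffZr p y a v : mdiff p y (a *: v) = a * mdiff p y v.
Proof. by rewrite /mdiff mulr_sumr; apply: eq_bigr => i _ /=; rewrite mxE mulrCA. Qed.

End Mdiff.

Section Taylor.
Variables (F : comNzRingType) (m : nat) (x : 'rV[F]_m).
Local Notation S := {mpoly F[m]}.

(** These generate the ideal of the point x. *)
Definition centered i : S := 'X_i - (x 0 i)%:MP.

Lemma meval_centered i y : (centered i).@[y] = y i - x 0 i.
Proof. by rewrite mevalB mevalXU mevalC. Qed.

Definition linear_part (p : S) : S := \sum_j (p^`M(j)).@[x 0] *: centered j.

Lemma linear_part_ideal_pow p : ideal_pow centered 1 (linear_part p).
Proof.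
apply: ideal_pred_sum => [|j _]; first exact: ideal_pow_ideal.
by rewrite -mul_mpolyC mulrC; apply: ideal_pow_gen.
Qed.

Lemma taylor2 (p : S) : ideal_pow centered 2 (p - (p.@[x 0])%:MP - linear_part p).
Proof.
have [m0 mD mM] := ideal_pow_ideal centered 2.
elim/mpoly_ring_ind: p => [c|i|p q hp hq|p q hp hq].
- rewrite mevalC subrr sub0r /linear_part big1 ?oppr0 // => j _.
  by rewrite mderivC meval0 scale0r.
- rewrite mevalXU /linear_part (bigD1 i) //= mderivXi eqxx meval1 scale1r.
  rewrite big1 ?addr0 ?subrr // => j.
  by rewrite mderivXi eq_sym => /negPf->; rewrite meval0 scale0r.
- have -> : linear_part (p + q) = linear_part p + linear_part q.
    rewrite /linear_part -big_split; apply: eq_bigr => j _ /=.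
    by rewrite mderivD mevalD scalerDl.
  rewrite mevalD mpolyCD.
  have := mD _ _ hp hq; congr (ideal_pow _ _ _); ring.
have -> : linear_part (p * q) =
    linear_part p * (q.@[x 0])%:MP + (p.@[x 0])%:MP * linear_part q.
  rewrite /linear_part mulr_suml mulr_sumr -big_split; apply: eq_bigr => j _ /=.
  rewrite mderivM mevalD !mevalM -!mul_mpolyC mpolyCD !mpolyCM; ring.
rewrite mevalM mpolyCM.
set a := (p.@[x 0])%:MP in hp *; set b := (q.@[x 0])%:MP in hq *.
set r := p - a - _ in hp; set s := q - b - _ in hq.
have -> : p * q - a * b - (linear_part p * b + a * linear_part q) =
  linear_part p * linear_part q + q * r + (a + linear_part p) * s.
  by rewrite /r /s; ring.
apply: (mD); last exact: (mM).
apply: (mD); last exact: (mM).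
by apply: (@ideal_powM _ _ _ 1 1); apply: linear_part_ideal_pow.
Qed.

Lemma ideal_pow1_eval p : ideal_pow centered 1 p -> p.@[x 0] = 0.
Proof.
case=> g _ ->; rewrite raddf_sum big1 // => i _ /=.
by rewrite mevalM meval_centered subrr mul0r.
Qed.

Lemma ideal_pow1_of_eval p : p.@[x 0] = 0 -> ideal_pow centered 1 p.
Proof.
move=> px; rewrite -(subrK (linear_part p) p); have [_ mD _] := ideal_pow_ideal centered 1.
apply: mD; last exact: linear_part_ideal_pow.
by apply: ideal_powS; have := taylor2 p; rewrite px mpolyC0 subr0.
Qed.

End Taylor.

(** * Ideals stable under an Euler field *)

Section EulerField.
Variables (C : fieldType) (m : nat).
Hypothesis C0 : [pchar C] =i pred0.
Local Notation S := {mpoly C[m]}.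
(* D is the vector field with components F. The hypothesis Euler says that D is
   the identity on M / M^2 modulo I, where M is the ideal of the point x. *)
Variables (x : 'rV[C]_m) (F : 'I_m -> S) (I J : S -> Prop).

Let t : 'I_m -> S := centered x.
Let D (p : S) : S := \sum_i p^`M(i) * F i.
(* Membership in M^k + I. *)
Let mI k f := exists2 g, ideal_pow t k g & I (f - g).

Hypothesis iI : ideal_pred I.
Hypothesis JI_D : forall p, J p -> exists2 g : 'I_m -> S,
  forall i, J (g i) & I (D p - \sum_i t i * g i).
Hypothesis I_D : forall p, I p -> I (D p).
Hypothesis Euler : forall i, mI 2 (F i - t i).
Hypothesis J_m : forall p, J p -> ideal_pow t 1 p.

Let mI_ideal k : ideal_pred (mI k).
Proof.
have [I0 ID IM] := iI; have [m0 mD mM] := ideal_pow_ideal t k.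
split=> [|a b [g gk Ig] [h hk Ih]|c a [g gk Ig]].
- by exists 0; rewrite ?subr0.
- exists (g + h); first exact: mD.
  by rewrite opprD addrACA; apply: ID.
- exists (c * g); first exact: mM.
  by rewrite -mulrBr; apply: IM.
Qed.

Let mI_ideal_pow k f : ideal_pow t k f -> mI k f.
Proof. by move=> fk; exists f; rewrite ?subrr //; case: iI. Qed.

Let mI_I k f : I f -> mI k f.
Proof. by move=> If; exists 0; rewrite ?subr0 //; case: (ideal_pow_ideal t k). Qed.

Let mIM k l f g : mI k f -> ideal_pow t l g -> mI (k + l) (f * g).
Proof.
case=> h hk Ih gl; exists (h * g); first exact: ideal_powM.
by rewrite -mulrBl mulrC; case: iI => _ _; apply.
Qed.

Let mIS k f : mI k.+1 f -> mI k f.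
Proof. by case=> h hk Ih; exists h => //; apply: ideal_powS. Qed.

Let DD p q : D (p + q) = D p + D q.
Proof. by rewrite -big_split; apply: eq_bigr => i _; rewrite /= mderivD mulrDl. Qed.

Let DM p q : D (p * q) = D p * q + p * D q.
Proof.
rewrite mulr_suml mulr_sumr -big_split; apply: eq_bigr => i _ /=.
by rewrite mderivM; ring.
Qed.

Let Dt i : D (t i) = F i.
Proof.
rewrite /D (bigD1 i) //= big1 => [|j ji].
  rewrite addr0 mderivB mderivC subr0 mderivX mnm1E eqxx.
  by rewrite -{1}[U_(i)%MM]add0m addmK mpolyX0 scale1r mul1r.
by rewrite mderivB mderivC subr0 mderivX mnm1E eq_sym (negPf ji) scale0r mul0r.
Qed.

(** D is a derivation, so that its action by 1 on M / M^2 forces its action by k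
    on M^k / M^(k+1). *)
Let euler_ideal_pow k f : ideal_pow t k f -> mI k.+1 (D f - f *+ k).
Proof.
have mI0 k' : mI k' 0 by case: (mI_ideal k').
elim: k f => [|k IH] f.
  move=> _; rewrite mulr0n subr0; apply: ideal_pred_sum => // i _.
  have -> : f^`M(i) * F i = f^`M(i) * (F i - t i) + f^`M(i) * t i by ring.
  have [_ mD mM] := mI_ideal 1; apply: mD; apply: mM; first exact/mIS.
  apply: mI_ideal_pow; rewrite -[t i]mulr1; exact: ideal_pow_gen.
case=> g gk ->.
have -> : D (\sum_i t i * g i) - (\sum_i t i * g i) *+ k.+1 =
    \sum_i ((F i - t i) * g i + t i * (D (g i) - g i *+ k)).
  rewrite (big_morph D DD (_ : D 0 = 0)); last first.
    by rewrite /D big1 // => i _; rewrite mderiv0 mul0r.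
  rewrite -sumrMnl -sumrB; apply: eq_bigr => i _; rewrite DM Dt mulrSr.
  by rewrite -mulrnAr; ring.
apply: ideal_pred_sum => // i _; have [_ mD _] := mI_ideal k.+2; apply: mD.
  exact: (mIM (Euler i) (gk i)).
have [h hk Ih] := IH _ (gk i).
exists (t i * h); first exact: ideal_pow_gen.
by rewrite -mulrBr; case: iI => _ _; apply.
Qed.

(** Suppose that J lies in M^k + I, with k > 0. For p in J, D p is k p modulo
    M^(k+1) + I, while D p is in MJ + I, which lies in M^(k+1) + I. In
    characteristic 0 this puts p in M^(k+1) + I. *)
Lemma stable_sub_ideal_pow k p :
  J p -> exists2 f, ideal_pow (centered x) k f & I (p - f).
Proof.
elim: k p => [|[|k] IH] p Jp; first by exists p; rewrite ?subrr //; case: iI.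
  by apply: mI_ideal_pow; apply: J_m.
have [f fk If] := IH p Jp.
have k0 : k.+1%:R != 0 :> C by rewrite ((pcharf0P C).1 C0).
have [_ mD mM] := mI_ideal k.+2.
suff : mI k.+2 (p *+ k.+1).
  move=> /(mM (k.+1%:R^-1)%:MP).
  by rewrite -[p *+ _]mulr_natl mulrA -mpolyC_nat -mpolyCM mulVf // mpolyC1 mul1r.
have -> : p *+ k.+1 = D p - ((D f - f *+ k.+1) + (D (p - f) - (p - f) *+ k.+1)).
  rewrite -(subrK f p) !(DD (_ - f)) addrK mulrnDl; ring.
apply: ideal_predB => //.
  have [g gJ Ig] := JI_D Jp.
  rewrite -(subrK (\sum_i t i * g i) (D p)); apply: mD; first exact: mI_I.
  apply: ideal_pred_sum => // i _.
  have [h hk Ih] := IH _ (gJ i).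
  exists (t i * h); first exact: ideal_pow_gen.
  by rewrite -mulrBr; case: iI => _ _; apply.
apply: mD; first exact: euler_ideal_pow.
apply: mI_I; apply: ideal_predB; rewrite ?mulr_natl //; first exact: I_D.
by rewrite -mulr_natl; case: iI => _ _; apply.
Qed.

End EulerField.

(** * Constructible sets *)

Section Constructible.
Variables (F : fieldType) (F_closed : GRing.closed_field_axiom F).

Definition row_env m (y : 'rV[F]_m) : seq F := [seq y 0 i | i <- enum 'I_m].

Lemma nth_row_env m (y : 'rV[F]_m) (i : 'I_m) : (row_env y)`_i = y 0 i.
Proof. by rewrite (nth_map i) ?size_enum_ord // nth_ord_enum. Qed.

(** Constructible subsets of affine space, that is boolean combinations of
    Zariski closed subsets, presented by quantifier-free formulas. *)
Definition qf_definable m (A : 'rV[F]_m -> Prop) : Prop :=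
  exists2 f : GRing.formula F, GRing.qf_form f && GRing.rformula f &
    forall y, A y <-> GRing.qf_eval (row_env y) f.

(** The polynomial p as a term in the variables k, k + 1, ... *)
Definition mterm N k (p : {mpoly F[N]}) : GRing.term F :=
  \big[GRing.Add/GRing.Const 0]_(a <- msupp p) GRing.Mul (GRing.Const p@_a)
    (\big[GRing.Mul/GRing.Const 1]_(i < N) GRing.Exp (GRing.Var F (k + i)) (a i)).

Lemma rterm_mterm N k (p : {mpoly F[N]}) : GRing.rterm (mterm k p).
Proof.
apply: (big_ind (fun t => GRing.rterm t)) => //= [s t -> -> //|a _].
by apply: (big_ind (fun t => GRing.rterm t)) => //= s t -> ->.
Qed.

Lemma eval_mterm N k (p : {mpoly F[N]}) (e : seq F) :
  GRing.eval e (mterm k p) = p.@[fun i => e`_(k + i)].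
Proof.
rewrite mevalE /mterm (big_morph (GRing.eval e) (id1 := 0) (op1 := +%R)) //.
apply: eq_bigr => a _ /=; congr (_ * _).
by rewrite (big_morph (GRing.eval e) (id1 := 1) (op1 := *%R)).
Qed.

Lemma holds_foldr_And T (r : seq T) (f : T -> GRing.formula F) e :
  GRing.holds e (foldr GRing.And (GRing.Bool true) (map f r)) <->
  foldr (fun x P => GRing.holds e (f x) /\ P) True r.
Proof. by elim: r => //= x r IH; split=> -[? /IH]. Qed.

Lemma foldr_conjP (T : eqType) (r : seq T) (P : T -> Prop) :
  foldr (fun x Q => P x /\ Q) True r <-> forall x, x \in r -> P x.
Proof.
elim: r => //= x r IH; split=> [[Px /IH Pr] y|Pr].
  by rewrite inE => /predU1P[->|/Pr].
split; first by apply: Pr; rewrite mem_head.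
by apply/IH => y yr; apply: Pr; rewrite inE yr orbT.
Qed.

Lemma rformula_foldr_And T (r : seq T) (f : T -> GRing.formula F) :
  (forall x, GRing.rformula (f x)) ->
  GRing.rformula (foldr GRing.And (GRing.Bool true) (map f r)).
Proof. by move=> rf; elim: r => //= x r ->; rewrite rf. Qed.

(** Chevalley's theorem for the image under G of the locally closed set where all
    polynomials of s vanish and h does not. The variables of index i < m stand
    for the point y of the target, the next N for a preimage w. *)
Lemma qf_definable_image m N (s : seq {mpoly F[N]}) (h : {mpoly F[N]})
    (G : 'I_m -> {mpoly F[N]}) :
  qf_definable (fun y : 'rV[F]_m => exists w : 'I_N -> F,
    [/\ forall p, p \in s -> p.@[w] = 0, h.@[w] <> 0 &
        forall i, y 0 i = (G i).@[w]]).
Proof.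
pose eq0 (p : {mpoly F[N]}) := GRing.Equal (mterm m p) (GRing.Const 0).
pose eqG (i : 'I_m) := GRing.Equal (GRing.Var F i) (mterm m (G i)).
pose body := GRing.And (foldr GRing.And (GRing.Bool true) (map eq0 s))
  (GRing.And (GRing.Not (eq0 h))
    (foldr GRing.And (GRing.Bool true) (map eqG (enum 'I_m)))).
pose f := foldr GRing.Exists body (iota m N).
have rf : GRing.rformula f.
  have : GRing.rformula body.
    rewrite /= !rformula_foldr_And //= ?rterm_mterm // => x.
      by rewrite /= rterm_mterm.
    by rewrite /= rterm_mterm.
  by rewrite /f; elim: (iota m N).
exists (GRing.quantifier_elim (@ClosedFieldQE.ex_elim F) f).
  exact: GRing.quantifier_elim_wf (@ClosedFieldQE.wf_ex_elim F) _ rf.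
move=> y.
have qeP := GRing.quantifier_elim_rformP (@ClosedFieldQE.wf_ex_elim F)
  (ClosedFieldQE.holds_ex_elim F_closed) (row_env y) rf.
have szE : size (row_env y) = m by rewrite size_map size_enum_ord.
split=> [[w [sw hw yG]]|/qeP/GRing.foldExistsP[e ye [es [eh eG]]]].
  apply/qeP/GRing.foldExistsP.
  pose e := row_env y ++ [seq w i | i <- enum 'I_N].
  have eN (i : 'I_N) : e`_(m + i) = w i.
    rewrite nth_cat szE ltnNge leq_addr /= addKn.
    by rewrite (nth_map i) ?size_enum_ord // nth_ord_enum.
  have em (i : 'I_m) : e`_i = y 0 i.
    by rewrite nth_cat szE ltn_ord nth_row_env.
  have ev p : GRing.eval e (mterm m p) = p.@[w].
    by rewrite eval_mterm; apply: meval_eq.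
  exists e.
    move=> j; rewrite !inE mem_iota => /nandP[|]; rewrite -?leqNgt -?ltnNge => jm.
      by rewrite nth_cat szE jm.
    rewrite [LHS]nth_default ?szE ?(leq_trans (leq_addr _ _) jm) //.
    by rewrite nth_default // size_cat szE size_map size_enum_ord.
  split; last split.
  - by apply/holds_foldr_And/foldr_conjP => p /sw pw; rewrite /= ev.
  - by rewrite /= ev.
  - by apply/holds_foldr_And/foldr_conjP => i _; rewrite /= em ev.
exists (fun i => e`_(m + i)); split.
- by move: es => /holds_foldr_And/foldr_conjP es p /es /=; rewrite eval_mterm.
- by move: eh => /=; rewrite eval_mterm.
move: eG => /holds_foldr_And/foldr_conjP eG i.
have := eG i (mem_enum _ _); rewrite /= eval_mterm => <-.
by rewrite -nth_row_env ye // !inE mem_iota leqNgt ltn_ord.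
Qed.

(** The ideal of K is prime. *)
Definition irreducible_cone m (K : 'rV[F]_m -> Prop) : Prop :=
  (exists y, K y) /\
  forall p q : {mpoly F[m]}, (forall y, K y -> (p * q).@[y 0] = 0) ->
    (forall y, K y -> p.@[y 0] = 0) \/ (forall y, K y -> q.@[y 0] = 0).

Lemma term_mpoly m (t : GRing.term F) : GRing.rterm t ->
  exists p : {mpoly F[m]}, forall y, GRing.eval (row_env y) t = p.@[y 0].
Proof.
elim: t => //= [i|c|k|s IHs t IHt|s IHs|s IHs k|s IHs t IHt|s IHs k].
- move=> _; have [im|mi] := ltnP i m.
    by exists 'X_(Ordinal im) => y; rewrite mevalXU -nth_row_env.
  exists 0 => y; rewrite meval0 nth_default //.
  by rewrite size_map size_enum_ord.
- by move=> _; exists c%:MP => y; rewrite mevalC.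
- by move=> _; exists k%:R => y; rewrite rmorph_nat.
- by case/andP=> /IHs[p pP] /IHt[q qP]; exists (p + q) => y; rewrite mevalD pP qP.
- by move/IHs=> [p pP]; exists (- p) => y; rewrite mevalN pP.
- by move/IHs=> [p pP]; exists (p *+ k) => y; rewrite mevalMn pP.
- by case/andP=> /IHs[p pP] /IHt[q qP]; exists (p * q) => y; rewrite mevalM pP qP.
- by move/IHs=> [p pP]; exists (p ^+ k) => y; rewrite rmorphXn /= pP.
Qed.

(** On the irreducible set K every polynomial equation holds everywhere or fails
    on a nonempty open subset, and these open subsets, the sets where some h is
    nonzero, are stable under finite intersections. *)
Lemma qf_dichotomy m (K A : 'rV[F]_m -> Prop) :
    irreducible_cone K -> qf_definable A ->
  exists h : {mpoly F[m]}, ~ (forall y, K y -> h.@[y 0] = 0) /\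
    ((forall y, K y -> h.@[y 0] <> 0 -> A y) \/
     (forall y, K y -> h.@[y 0] <> 0 -> ~ A y)).
Proof.
move=> [[y0 Ky0] irrK] [f /andP[qf rf] Af].
suff [h [hN0 hA]] : exists h : {mpoly F[m]},
    ~ (forall y, K y -> h.@[y 0] = 0) /\ exists b, forall y, K y ->
      h.@[y 0] <> 0 -> GRing.qf_eval (row_env y) f = b.
  exists h; split=> //; case: hA => -[] hb; [left|right] => y Ky /(hb y Ky) fb.
    exact/Af.
  by move/Af; rewrite fb.
have one_neq : ~ (forall y, K y -> (1 : {mpoly F[m]}).@[y 0] = 0).
  by move/(_ _ Ky0)/eqP; rewrite meval1 oner_eq0.
have comb f1 f2 (op : bool -> bool -> bool) :
  (exists h : {mpoly F[m]},
    ~ (forall y, K y -> h.@[y 0] = 0) /\ exists b, forall y, K y ->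
      h.@[y 0] <> 0 -> GRing.qf_eval (row_env y) f1 = b) ->
  (exists h : {mpoly F[m]},
    ~ (forall y, K y -> h.@[y 0] = 0) /\ exists b, forall y, K y ->
      h.@[y 0] <> 0 -> GRing.qf_eval (row_env y) f2 = b) ->
  (exists h : {mpoly F[m]},
    ~ (forall y, K y -> h.@[y 0] = 0) /\ exists b, forall y, K y ->
      h.@[y 0] <> 0 ->
      op (GRing.qf_eval (row_env y) f1) (GRing.qf_eval (row_env y) f2) = b).
  move=> [h1 [h1N [b1 hb1]]] [h2 [h2N [b2 hb2]]].
  exists (h1 * h2); split; first by move=> /irrK[].
  exists (op b1 b2) => y Ky; rewrite mevalM => /eqP.
  by rewrite mulf_eq0 => /norP[/eqP h1y /eqP h2y]; rewrite hb1 // hb2.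
elim: f {Af} qf rf => //= [b|t1 t2|f1 IH1 f2 IH2|f1 IH1 f2 IH2|f1 IH1 f2 IH2|f1 IH1].
- by move=> _ _; exists 1; split=> //; exists b.
- move=> _ /andP[/(term_mpoly m)[p1 p1P] /(term_mpoly m)[p2 p2P]].
  have [p0|pN0] := pselect (forall y, K y -> (p1 - p2).@[y 0] = 0).
    exists 1; split=> //; exists true => y /p0 /eqP.
    by rewrite p1P p2P mevalB subr_eq0.
  exists (p1 - p2); split=> //; exists false => y _ /eqP.
  by rewrite p1P p2P mevalB subr_eq0 => /negPf.
- by case/andP=> q1 q2 /andP[r1 r2]; apply: (comb f1 f2 andb); [apply: IH1 | apply: IH2].
- by case/andP=> q1 q2 /andP[r1 r2]; apply: (comb f1 f2 orb); [apply: IH1 | apply: IH2].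
- by case/andP=> q1 q2 /andP[r1 r2]; apply: (comb f1 f2 implb); [apply: IH1 | apply: IH2].
- move=> q1 r1; have := comb f1 f1 (fun b _ => ~~ b) (IH1 q1 r1) (IH1 q1 r1); exact.
Qed.

(** A dense constructible subset contains a nonempty open subset of K, because the
    other alternative of the dichotomy makes its complement contain one; two
    nonempty open subsets of K meet. *)
Lemma dense_definable_meet m (K A B : 'rV[F]_m -> Prop) :
    irreducible_cone K -> (forall y, A y -> K y) -> (forall y, B y -> K y) ->
    qf_definable A -> qf_definable B ->
    (forall p : {mpoly F[m]}, (forall y, A y -> p.@[y 0] = 0) ->
       forall y, K y -> p.@[y 0] = 0) ->
    (forall p : {mpoly F[m]}, (forall y, B y -> p.@[y 0] = 0) ->
       forall y, K y -> p.@[y 0] = 0) ->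
  exists2 y, A y & B y.
Proof.
move=> irrK AK BK dA dB denseA denseB.
have main D : (forall y, D y -> K y) -> qf_definable D ->
    (forall p : {mpoly F[m]}, (forall y, D y -> p.@[y 0] = 0) ->
       forall y, K y -> p.@[y 0] = 0) ->
    exists2 h : {mpoly F[m]}, ~ (forall y, K y -> h.@[y 0] = 0) &
      forall y, K y -> h.@[y 0] <> 0 -> D y.
  move=> DK dD denseD; have [h [hN [hD|hD]]] := qf_dichotomy irrK dD.
    by exists h.
  case: hN; apply: denseD => y Dy; apply: contrapT => hy.
  exact: hD (DK y Dy) hy Dy.
have [h hN hA] := main A AK dA denseA; have [k kN kB] := main B BK dB denseB.
have [_ prime] := irrK.
have hkN : ~ (forall y, K y -> (h * k).@[y 0] = 0) by move/prime=> [].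
have [y /not_implyP[Ky]] : exists y, ~ (K y -> (h * k).@[y 0] = 0).
  exact/existsNP.
rewrite mevalM => /eqP; rewrite mulf_eq0 => /norP[/eqP hy /eqP ky].
by exists y; [apply: hA | apply: kB].
Qed.

End Constructible.

(** * Limits and the matrix exponential *)

Section Limits.
Local Open Scope classical_set_scope.
Local Open Scope complex_scope.
Local Open Scope ring_scope.
Variable R : realType.
Local Notation C := R[i].

(** The bounds u n - 2 c r^(n+1) increase and the bounds u n + 2 c r^(n+1)
    decrease, since r <= 1/2; the limit is the supremum of the lower bounds. *)
Lemma geometric_limit_real (u : nat -> R) (c r : R) :
    0 <= c -> 0 <= r -> r <= 2^-1 ->
    (forall n, `|u n.+1 - u n| <= c * r ^+ n.+1) ->
  exists l, forall n, `|l - u n| <= 2 * c * r ^+ n.+1.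
Proof.
move=> c0 r0 r2 du.
pose lo n := u n - 2 * c * r ^+ n.+1; pose hi n := u n + 2 * c * r ^+ n.+1.
have half n : 2 * c * r ^+ n.+2 <= c * r ^+ n.+1.
  have : 0 <= c * r ^+ n.+1 by rewrite mulr_ge0 ?exprn_ge0.
  have -> : 2 * c * r ^+ n.+2 = (c * r ^+ n.+1) * (2 * r) by rewrite exprS; ring.
  by move=> cr; rewrite ler_piMr // -ler_pdivlMl ?mulr1.
have lo_incr n k : lo n <= lo (n + k)%N.
  elim: k => [|k IH]; first by rewrite addn0.
  apply: (le_trans IH); rewrite addnS /lo.
  have := du (n + k)%N; have := half (n + k)%N; rewrite ler_norml => ? /andP[? ?]; lra.
have hi_decr n k : hi (n + k)%N <= hi n.
  elim: k => [|k IH]; first by rewrite addn0.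
  apply: le_trans IH; rewrite addnS /hi.
  have := du (n + k)%N; have := half (n + k)%N; rewrite ler_norml => ? /andP[? ?]; lra.
have lohi n k : lo n <= hi k.
  apply: (le_trans (lo_incr n k)); rewrite addnC; apply: le_trans (hi_decr k n).
  have : 0 <= c * r ^+ (k + n).+1 by rewrite mulr_ge0 ?exprn_ge0.
  rewrite /lo /hi => ?; lra.
exists (sup (range lo)) => n; rewrite ler_distl; apply/andP; split.
  apply: ub_le_sup; last by exists n.
  by exists (hi 0%N) => _ [k _ <-]; apply: lohi.
by apply: ge_sup; [exists (lo 0%N); exists 0%N | move=> _ [k _ <-]; apply: lohi].
Qed.

Lemma Re_le_norm (z : C) : `|complex.Re z| <= complex.Re `|z|.
Proof. by have := normc_ge_Re z; rewrite lecE => /andP[_]. Qed.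

Lemma Im_le_norm (z : C) : `|complex.Im z| <= complex.Re `|z|.
Proof.
have := Re_le_norm (z * 'i); rewrite ReiNIm normrN normrM.
by rewrite (_ : `|'i%C : C| = 1) ?mulr1 // normc_def /= expr0n /= add0r expr1n sqrtr1.
Qed.

Lemma norm_le_ReIm (z : C) : `|z| <= (`|complex.Re z| + `|complex.Im z|)%:C.
Proof.
have -> : `|z| = `|(complex.Re z)%:C + 'i%C * (complex.Im z)%:C| by rewrite -complexE.
apply: (le_trans (ler_normD _ _)); rewrite normrM.
rewrite (_ : `|'i%C : C| = 1) ?mul1r; last first.
  by rewrite normc_def /= expr0n /= add0r expr1n sqrtr1.
by rewrite !normc_def /= !expr0n /= !addr0 !sqrtr_sqr rmorphD.
Qed.

Lemma ge0_ReC (c : C) : 0 <= c -> (complex.Re c)%:C = c.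
Proof. by move=> c0; rewrite RRe_real // ger0_real. Qed.

Lemma ge0_Re (c : C) : 0 <= c -> 0 <= complex.Re c.
Proof. by rewrite lecE => /andP[]. Qed.

Lemma geometric_limit (u : nat -> C) (r : C) :
    0 <= r -> r <= 2^-1 ->
    (forall n, `|u n.+1 - u n| <= r ^+ n.+1) ->
  exists l, forall n, `|l - u n| <= 4 * r ^+ n.+1.
Proof.
move=> r0 r2 du; set s := complex.Re r; have rE : r = s%:C by rewrite ge0_ReC.
have s0 : 0 <= s by apply: ge0_Re.
have s2 : s <= 2^-1.
  by rewrite -lecR -rE fmorphV /= rmorph_nat.
have rXE n : r ^+ n = (s ^+ n)%:C by rewrite rE rmorphXn.
have duR n : complex.Re `|u n.+1 - u n| <= s ^+ n.+1.
  by have := du n; rewrite rXE lecE => /andP[].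
have [a aP] := @geometric_limit_real (fun n => complex.Re (u n)) 1 s ler01 s0 s2
  (fun n => ltac:(rewrite mul1r -raddfB; exact: le_trans (Re_le_norm _) (duR n))).
have [b bP] := @geometric_limit_real (fun n => complex.Im (u n)) 1 s ler01 s0 s2
  (fun n => ltac:(rewrite mul1r -raddfB; exact: le_trans (Im_le_norm _) (duR n))).
exists (a +i* b) => n; apply: (le_trans (norm_le_ReIm _)).
rewrite rXE -(rmorph_nat (real_complex R) 4) -rmorphM lecR !raddfB /=.
have := aP n; have := bP n; lra.
Qed.

Lemma squeeze0 (x K : C) : (forall n, `|x| <= K / 2 ^+ n) -> x = 0.
Proof.
move=> xK; apply/eqP; rewrite -normr_le0; set a := complex.Re `|x|.
have aE : `|x| = a%:C by rewrite ge0_ReC.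
have K0 : 0 <= K by have := xK 0%N; rewrite expr0 divr1; apply: le_trans.
have KE : K = (complex.Re K)%:C by rewrite ge0_ReC.
rewrite aE lecR leNgt; apply/negP => a0.
have h n : a * 2 ^+ n <= complex.Re K.
  have := xK n; rewrite ler_pdivlMr ?exprn_gt0 // aE {1}KE.
  by rewrite -(rmorph_nat (real_complex R) 2) -rmorphXn -rmorphM lecR.
have := upper_nthrootP (leqnn (Num.bound (complex.Re K / a))).
by rewrite ltr_pdivrMr // mulrC ltNge h.
Qed.

End Limits.

Section Exponential.
Variable R : realType.
Local Notation C := R[i].
Variable m : nat.
Implicit Types (B Q : 'M[C]_m).

(** The term B^k / k! of the exponential series. *)
Fixpoint expterm B k : 'M[C]_m :=
  if k is k'.+1 then k%:R^-1 *: (B *m expterm B k') else 1%:M.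

Arguments expterm : simpl never.

Lemma expterm0 B : expterm B 0 = 1%:M.
Proof. by []. Qed.

Lemma exptermS B k : k.+1%:R *: expterm B k.+1 = B *m expterm B k.
Proof. by rewrite /expterm scalerA divff ?scale1r ?pnatr_eq0. Qed.

Definition expsum B N := \sum_(k < N.+1) expterm B k.

Lemma mulmx_bound (a b : C) p q s (X : 'M[C]_(p, q)) (Y : 'M[C]_(q, s)) :
    0 <= a -> (forall i j, `|X i j| <= a) -> (forall i j, `|Y i j| <= b) ->
  forall i j, `|(X *m Y) i j| <= q%:R * (a * b).
Proof.
move=> a0 Xa Yb i j; rewrite mxE; apply: (le_trans (ler_norm_sum _ _ _)).
rewrite -[q in q%:R]card_ord -sum1_card natr_sum mulr_suml.
by apply: ler_sum => k _; rewrite mul1r normrM ler_pM.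
Qed.

(** The factor m accounts for the m summands in an entry of a matrix product. *)
Lemma expterm_bound B (r : C) k :
    (forall i j, m%:R * `|B i j| <= r) ->
  forall i j, `|expterm B k i j| <= r ^+ k.
Proof.
move=> Br; elim: k => [|k IH] i j.
  by rewrite expterm0 mxE expr0; case: (i == j); rewrite ?normr1 ?normr0 ?ler01.
have m0 : (0 < m%:R :> C) by rewrite ltr0n (leq_ltn_trans _ (ltn_ord i)).
have r0 : 0 <= r by apply: le_trans (Br i j); rewrite mulr_ge0.
have -> : expterm B k.+1 i j = (B *m expterm B k) i j / k.+1%:R.
  by rewrite -exptermS [in RHS]mxE mulrC mulKf ?pnatr_eq0.
rewrite normrM normfV normr_nat ler_pdivrMr ?ltr0n //.
have Br' i' j' : `|B i' j'| <= r / m%:R by rewrite ler_pdivlMr // mulrC.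
have rm0 : 0 <= r / m%:R by rewrite divr_ge0 // ltW.
apply: (le_trans (mulmx_bound rm0 Br' IH i j)).
have -> : m%:R * (r / m%:R * r ^+ k) = 1 * r ^+ k.+1.
  by rewrite mulrA mulrCA mulfV ?gt_eqF // mulr1 mul1r exprS.
by rewrite mulrC ler_wpM2l ?exprn_ge0 // ler1n.
Qed.

Lemma exp_exists B (r : C) :
    0 <= r -> r <= 2^-1 -> (forall i j, m%:R * `|B i j| <= r) ->
  exists E : 'M[C]_m, forall N i j, `|E i j - expsum B N i j| <= 4 * r ^+ N.+1.
Proof.
move=> r0 r2 Br.
have /choice[e eP] : forall ij : 'I_m * 'I_m, exists l : C, forall N,
    `|l - expsum B N ij.1 ij.2| <= 4 * r ^+ N.+1.
  move=> ij; apply: geometric_limit => // N.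
  rewrite /expsum big_ord_recr /= mxE addrAC subrr add0r.
  exact: expterm_bound.
by exists (\matrix_(i, j) e (i, j)) => N i j; rewrite mxE; apply: eP (i, j) N.
Qed.

(** The term of degree s in the product of the series exp(B) Q exp(B)^T. *)
Definition conjterm B Q s := \sum_(k < s.+1) expterm B k *m Q *m (expterm B (s - k))^T.

(** conjterm B Q s is 1 / s! times the s-th iterate on Q of the operator
    Q |-> B Q + Q B^T; this is the recurrence that proves it. *)
Lemma conjtermS B Q s : s.+1%:R *: conjterm B Q s.+1 =
  B *m conjterm B Q s + conjterm B Q s *m B^T.
Proof.
rewrite /conjterm scaler_sumr.
have -> : \sum_(k < s.+2) s.+1%:R *: (expterm B k *m Q *m (expterm B (s.+1 - k))^T) =
   \sum_(k < s.+2) k%:R *: (expterm B k *m Q *m (expterm B (s.+1 - k))^T) +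
   \sum_(k < s.+2) (s.+1 - k)%:R *: (expterm B k *m Q *m (expterm B (s.+1 - k))^T).
  rewrite -big_split; apply: eq_bigr => k _ /=.
  by rewrite -scalerDl -natrD subnKC // -ltnS.
congr (_ + _).
  rewrite big_ord_recl scale0r add0r mulmx_sumr; apply: eq_bigr => k _ /=.
  by rewrite /bump /= add1n subSS !scalemxAl exptermS !mulmxA.
rewrite big_ord_recr /= subnn scale0r addr0 mulmx_suml; apply: eq_bigr => k _ /=.
rewrite subSn ?leq_ord // -[RHS]mulmxA -trmx_mul -exptermS [in RHS]linearZ -scalemxAr.
by [].
Qed.

Lemma conjterm_mem B (U : {vspace 'M[C]_m}) :
    (forall Q, Q \in U -> B *m Q + Q *m B^T \in U) ->
  forall Q s, Q \in U -> conjterm B Q s \in U.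
Proof.
move=> BU Q s QU; elim: s => [|s IH].
  by rewrite /conjterm big_ord1 !expterm0 trmx1 mulmx1 mul1mx.
have s0 : s.+1%:R != 0 :> C by rewrite pnatr_eq0.
rewrite -[conjterm _ _ _]scale1r -(mulVf s0) -scalerA conjtermS.
by apply/memvZ/BU.
Qed.

Lemma sum_triangle (V : zmodType) N (F : nat -> nat -> V) :
  \sum_(s < N.+1) \sum_(k < s.+1) F k (s - k)%N =
  \sum_(k < N.+1) \sum_(l < N.+1 | (k + l <= N)%N) F k l.
Proof.
transitivity (\sum_(s < N.+1) \sum_(k < N.+1 | (k <= s)%N) F k (s - k)%N).
  apply: eq_bigr => s _.
  by rewrite (big_ord_widen N.+1 (fun k => F k (s - k)%N)).
rewrite (exchange_big_dep xpredT) //=; apply: eq_bigr => k _.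
have kN : (k <= N.+1)%N by apply: ltnW.
rewrite -(big_mkord (fun s => (k <= s)%N) (fun s => F k (s - k)%N)).
rewrite (@big_cat_nat _ _ _ k) //= big_nat_cond big1 ?add0r; last first.
  by move=> i /andP[/andP[_ ik] ki]; rewrite leqNgt ik in ki.
rewrite (big_addn 0 N.+1 k (fun s => (k <= s)%N) (fun s => F k (s - k)%N)).
rewrite -(big_mkord (fun l => (k + l <= N)%N) (fun l => F k l)).
rewrite [RHS](@big_cat_nat _ _ _ (N.+1 - k)) ?leq_subr //=.
rewrite [X in _ + X]big_nat_cond [X in _ + X]big1 ?addr0; last first.
  move=> i /andP[/andP[ik _] ki]; rewrite leq_subLR in ik.
  by have := leq_trans ik ki; rewrite ltnn.
rewrite big_nat_cond [RHS]big_nat_cond; apply: eq_big => [i|i _].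
  by rewrite leq_addl andbT /=; case: ltnP => //=; rewrite ltn_subRL.
by rewrite addnK.
Qed.

End Exponential.
Arguments expterm : simpl never.

Section Integration.
Variable R : realType.
Local Notation C := R[i].
Variable m : nat.
Implicit Types (A B Q : 'M[C]_m).

(** Each entry of the projection along U is a linear form, hence bounded by a
    multiple of the entries; it vanishes on U, so it is arbitrarily small at X. *)
Lemma vspace_closed (U : {vspace 'M[C]_m}) (X : 'M[C]_m) (K : C) :
    (forall N, exists2 Y, Y \in U & forall i j, `|X i j - Y i j| <= K / 2 ^+ N) ->
  X \in U.
Proof.
move=> XU; pose pr (Z : 'M[C]_m) := Z - projv U Z.
have prD Y Z : pr (Y + Z) = pr Y + pr Z by rewrite /pr linearD opprD addrACA.
have prZ a Z : pr (a *: Z) = a *: pr Z by rewrite /pr linearZ scalerBr.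
have pr0 : pr 0 = 0 by rewrite /pr linear0 subrr.
suff: pr X = 0.
  by move/eqP; rewrite subr_eq0 => /eqP->; apply: memv_proj.
apply/matrixP => i j; rewrite [RHS]mxE.
pose L := \sum_k \sum_l `|pr (delta_mx k l) i j|.
apply: (@squeeze0 _ _ (K * L)) => N; have [Y YU XY] := XU N.
have -> : pr X = pr (X - Y).
  by rewrite -{1}(subrK Y X) [LHS]prD [pr Y]/pr (projv_id YU) subrr addr0.
rewrite [X - Y]matrix_sum_delta (big_morph pr prD pr0) summxE.
rewrite mulrAC mulr_sumr; apply: (le_trans (ler_norm_sum _ _ _)).
apply: ler_sum => k _; rewrite (big_morph pr prD pr0) summxE mulr_sumr.
apply: (le_trans (ler_norm_sum _ _ _)); apply: ler_sum => l _.
by rewrite prZ !mxE normrM ler_wpM2r.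
Qed.

Lemma norm_entry_le (X : 'M[C]_m) i j : `|X i j| <= \sum_k \sum_l `|X k l|.
Proof.
rewrite (bigD1 i) //= (bigD1 j) //= -addrA lerDl.
by rewrite addr_ge0 ?sumr_ge0 // => k _; rewrite sumr_ge0.
Qed.

Lemma trmx_bound (a : C) (X : 'M[C]_m) :
  (forall i j, `|X i j| <= a) -> forall i j, `|X^T i j| <= a.
Proof. by move=> Xa i j; rewrite mxE. Qed.

(** E is the exponential of B. The partial sums of the conjterm B Q s are in U
    and approximate E Q E^T: they differ from the product of the partial sums
    of the exponential by terms of degree above N only, and r <= 1/8 is small
    enough for the (N + 1)^2 such terms, each of size r^N, to tend to 0. *)
Lemma exp_conj_mem B (r : C) (U : {vspace 'M[C]_m}) (E : 'M[C]_m) :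
    0 <= r -> r <= 8^-1 -> (forall i j, m%:R * `|B i j| <= r) ->
    (forall Q, Q \in U -> B *m Q + Q *m B^T \in U) ->
    (forall N i j, `|E i j - expsum B N i j| <= 4 * r ^+ N.+1) ->
  forall Q, Q \in U -> E *m Q *m E^T \in U.
Proof.
move=> r0 r8 Br BU Eexp Q QU.
pose q := \sum_i \sum_j `|Q i j|.
have Qq := norm_entry_le Q : forall i j, `|Q i j| <= q.
have q0 : 0 <= q by rewrite sumr_ge0 // => k _; rewrite sumr_ge0.
have r1 : r <= 1 by apply: (le_trans r8); rewrite invf_le1 ?ltr0n ?ler1n.
have r4 : 4 * r <= 2^-1.
  by rewrite (_ : 2^-1 = 4 * 8^-1) ?ler_pM2l ?ltr0n //; field.
have rN2 N : (4 * r) ^+ N <= 1 / 2 ^+ N.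
  by rewrite div1r -exprVn lerXn2r ?nnegrE ?invr_ge0 ?mulr_ge0.
have rS N : r ^+ N.+1 <= 1 / 2 ^+ N.
  apply: le_trans (rN2 N); rewrite exprMn exprS ler_pM ?exprn_ge0 //.
  by apply: (le_trans r1); rewrite exprn_ege1 ?ler1n.
have Eb i j : `|E i j| <= 5.
  rewrite -(subrK (expsum B 0 i j) (E i j)); apply: (le_trans (ler_normD _ _)).
  rewrite /expsum big_ord1 expterm0.
  have := Eexp 0%N i j; rewrite /expsum big_ord1 expterm0 expr1 => h.
  have h1 : `|(1%:M : 'M[C]_m) i j| <= 1.
    by rewrite mxE; case: (i == j); rewrite ?normr1 ?normr0 ?ler01.
  have h4 : 4 * r <= 4 by rewrite ler_piMr.
  by rewrite (_ : 5 = 4 + 1) ?lerD ?(le_trans h) //; ring.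
have dE N i j : `|(E - expsum B N) i j| <= 4 * (1 / 2 ^+ N).
  rewrite !mxE; apply: (le_trans (Eexp N i j)).
  by rewrite ler_wpM2l.
have ENb N i j : `|expsum B N i j| <= 9.
  rewrite -(subrK (E i j) (expsum B N i j)); apply: (le_trans (ler_normD _ _)).
  rewrite (_ : 9 = 4 + 5) ?lerD //; last by ring.
  rewrite distrC; apply: (le_trans (Eexp N i j)).
  by rewrite ler_piMr // exprn_ile1.
pose M := m%:R : C.
apply: (@vspace_closed U _ (M * (M * (4 * q) * 5) + M * (M * (9 * q) * 4) + M * M * q)).
move=> N; exists (\sum_(s < N.+1) conjterm B Q s).
  by apply: memv_suml => s _; apply: conjterm_mem.
move=> i j; set Y := \sum_(s < N.+1) _.
have YE : Y = \sum_(k < N.+1) \sum_(l < N.+1 | (k + l <= N)%N)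
    expterm B k *m Q *m (expterm B l)^T.
  by rewrite -(sum_triangle _ (fun k l => expterm B k *m Q *m (expterm B l)^T)).
have ENE : expsum B N *m Q *m (expsum B N)^T = Y +
    \sum_(k < N.+1) \sum_(l < N.+1 | ~~ (k + l <= N)%N)
      expterm B k *m Q *m (expterm B l)^T.
  rewrite YE -big_split /= /expsum !mulmx_suml; apply: eq_bigr => k _.
  rewrite raddf_sum mulmx_sumr.
  by rewrite (bigID (fun l : 'I_N.+1 => (k + l <= N)%N)).
have -> : (E *m Q *m E^T) i j - Y i j = ((E - expsum B N) *m Q *m E^T) i j +
    (expsum B N *m Q *m (E - expsum B N)^T) i j +
    \sum_(k < N.+1) \sum_(l < N.+1 | ~~ (k + l <= N)%N)
      (expterm B k *m Q *m (expterm B l)^T) i j.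
  have -> : \sum_(k < N.+1) \sum_(l < N.+1 | ~~ (k + l <= N)%N)
      (expterm B k *m Q *m (expterm B l)^T) i j =
      (expsum B N *m Q *m (expsum B N)^T) i j - Y i j.
    rewrite ENE [in RHS]mxE addrAC subrr add0r summxE.
    by apply: eq_bigr => k _; rewrite summxE.
  have addE (X Z : 'M[C]_m) : (X + Z) i j = X i j + Z i j by rewrite mxE.
  have -> : E *m Q *m E^T = (E - expsum B N) *m Q *m E^T +
      (expsum B N *m Q *m (E - expsum B N)^T + expsum B N *m Q *m (expsum B N)^T).
    have telescope (W : zmodType) (a b d : W) : a = a - b + (b - d + d).
      by rewrite !subrK.
    by rewrite linearB /= mulmxBr !mulmxBl; apply: telescope.
  by rewrite !addE !addrA.
have e0 : 0 <= 1 / 2 ^+ N :> C by rewrite divr_ge0 ?exprn_ge0.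
rewrite !mulrDl; apply: (le_trans (ler_normD _ _)).
apply: lerD; first (apply: (le_trans (ler_normD _ _)); apply: lerD).
- have p1 : 0 <= 4 * (1 / 2 ^+ N) :> C by rewrite mulr_ge0 ?ler0n.
  have p2 : 0 <= m%:R * (4 * (1 / 2 ^+ N) * q).
    by rewrite !mulr_ge0 ?invr_ge0 ?exprn_ge0 ?ler01 ?ler0n.
  apply: (le_trans (mulmx_bound p2 (mulmx_bound p1 (dE N) Qq) (trmx_bound Eb) i j)).
  by rewrite -/M div1r le_eqVlt; apply/orP; left; apply/eqP; set e := (2 ^+ N)^-1; ring.
- have p2 : 0 <= m%:R * (9 * q).
    by rewrite !mulr_ge0 ?invr_ge0 ?exprn_ge0 ?ler01 ?ler0n.
  have p1 : 0 <= 9 :> C by rewrite ler0n.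
  apply: (le_trans (mulmx_bound p2 (mulmx_bound p1 (ENb N) Qq) (trmx_bound (dE N)) i j)).
  by rewrite -/M div1r le_eqVlt; apply/orP; left; apply/eqP; set e := (2 ^+ N)^-1; ring.
have Tb k l : ~~ (k + l <= N)%N ->
    `|(expterm B k *m Q *m (expterm B l)^T) i j| <= M * M * q * r ^+ N.
  move=> klN; have p1 := exprn_ge0 k r0.
  have p2 : 0 <= m%:R * (r ^+ k * q).
    by rewrite !mulr_ge0 ?invr_ge0 ?exprn_ge0 ?ler01 ?ler0n.
  apply: (le_trans (mulmx_bound p2 (mulmx_bound p1 (expterm_bound k Br) Qq)
    (trmx_bound (expterm_bound l Br)) i j)).
  have -> : m%:R * (m%:R * (r ^+ k * q) * r ^+ l) = M * M * q * r ^+ (k + l).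
    by rewrite exprD /M; ring.
  rewrite ler_wpM2l ?mulr_ge0 // ler_wiXn2l // ltnW // ltnNge //.
apply: (le_trans (ler_norm_sum _ _ _)).
have -> : M * M * q / 2 ^+ N = M * M * q * (1 / 2 ^+ N) by rewrite mul1r.
apply: le_trans (_ : N.+1%:R * (N.+1%:R * (M * M * q * r ^+ N)) <= _); last first.
  have -> : N.+1%:R * (N.+1%:R * (M * M * q * r ^+ N)) =
      M * M * q * (N.+1%:R * N.+1%:R * r ^+ N) by ring.
  rewrite ler_wpM2l ?mulr_ge0 //; apply: le_trans (rN2 N).
  rewrite exprMn ler_wpM2r ?exprn_ge0 // -natrM -natrX ler_nat.
  by rewrite (_ : 4 = 2 * 2)%N // expnMn leq_mul // ltn_expl.
have const (P : pred 'I_N.+1) (G : 'I_N.+1 -> C) b :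
    0 <= b -> (forall k, P k -> G k <= b) -> \sum_(k < N.+1 | P k) G k <= N.+1%:R * b.
  move=> b0 Gb; rewrite -[X in X%:R * b]card_ord -sum1_card natr_sum mulr_suml.
  rewrite big_mkcond; apply: ler_sum => k _; rewrite mul1r.
  by case: ifP => // /Gb.
apply: (const) => [|k _]; first by rewrite !mulr_ge0 ?exprn_ge0.
apply: (le_trans (ler_norm_sum _ _ _)).
apply: (const) => [|l kl]; first by rewrite !mulr_ge0 ?exprn_ge0.
exact: Tb.
Qed.

End Integration.

Section Integration.
Variable R : realType.
Local Notation C := R[i].
Variable m : nat.
Implicit Types (A B Q : 'M[C]_m) (p : {mpoly C[m]}) (y u v : 'rV[C]_m).

(** First order Taylor expansion with a remainder that is uniform for u in a
    bounded set; this allows u to depend on t below. *)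
Lemma taylor_bound p y (c : C) : 0 <= c ->
  exists2 K : C, 0 <= K & forall t u, 0 <= t -> t <= 1 ->
    (forall i, `|u 0 i| <= c) ->
    `|mdiff p y u| <= K /\
    `|p.@[(y + t *: u) 0] - p.@[y 0] - t * mdiff p y u| <= K * t ^+ 2.
Proof.
move=> c0; elim/mpoly_ring_ind: p => [a|i|p q [K K0 pK] [L L0 qL]|p q [K K0 pK] [L L0 qL]].
- exists 0 => // t u t0 t1 uc; rewrite mdiffC !mevalC mulr0 subrr subr0 normr0.
  by rewrite mul0r.
- exists c => // t u t0 t1 uc; rewrite mdiffX !mevalXU !mxE; split; first exact: uc.
  by rewrite [X in `|X|](_ : _ = 0) ?normr0 ?mulr_ge0 ?exprn_ge0 //; ring.
- exists (K + L) => [|t u t0 t1 uc]; first exact: addr_ge0.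
  have [p1 p2] := pK t u t0 t1 uc; have [q1 q2] := qL t u t0 t1 uc.
  rewrite mdiffD !mevalD; split; first exact: (le_trans (ler_normD _ _)) (lerD p1 q1).
  have regroup (a b a' b' d e : C) :
      a + b - (a' + b') - t * (d + e) = (a - a' - t * d) + (b - b' - t * e) by ring.
  by rewrite mulrDl regroup; apply: (le_trans (ler_normD _ _)) (lerD p2 q2).
set P := `|p.@[y 0]|; set Q := `|q.@[y 0]|.
have P0 : 0 <= P by apply: normr_ge0.
have Q0 : 0 <= Q by apply: normr_ge0.
exists (K * L + K * (Q + L + L) + (P + K) * L) => [|t u t0 t1 uc].
  by rewrite !addr_ge0 ?mulr_ge0 ?addr_ge0.
have [p1 p2] := pK t u t0 t1 uc; have [q1 q2] := qL t u t0 t1 uc.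
rewrite mdiffM !mevalM; split.
  apply: (le_trans (ler_normD _ _)); rewrite !normrM -/P -/Q.
  have -> : K * L + K * (Q + L + L) + (P + K) * L =
    (K * Q + P * L) + (K * L + K * L + K * L + K * L) by ring.
  apply: le_trans (_ : K * Q + P * L <= _); first by rewrite lerD ?ler_wpM2r ?ler_wpM2l.
  by rewrite lerDl !addr_ge0 ?mulr_ge0.
set p' := p.@[_] in p2 *; set q' := q.@[_] in q2 *.
set a := p.@[y 0] in P P0 p2 *; set b := q.@[y 0] in Q Q0 q2 *.
set d := mdiff p y u in p1 p2 *; set e := mdiff q y u in q1 q2 *.
have -> : p' * q' - a * b - t * (d * b + a * e) =
    t ^+ 2 * (d * e) + (p' - a - t * d) * (b + t * e + (q' - b - t * e)) +
    (a + t * d) * (q' - b - t * e) by ring.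
have tn : `|t| <= 1 by rewrite ger0_norm.
have tt1 : t ^+ 2 <= 1 by rewrite exprn_ile1.
have tt0 : 0 <= t ^+ 2 by rewrite exprn_ge0.
rewrite [leRHS]mulrDl [X in _ <= X + _]mulrDl.
apply: (le_trans (ler_normD _ _)); apply: lerD.
  apply: (le_trans (ler_normD _ _)); apply: lerD.
    by rewrite normrM normrX (ger0_norm t0) mulrC ler_wpM2r // normrM ler_pM.
  rewrite normrM -mulrA [_ * t ^+ 2]mulrC mulrA ler_pM //.
  apply: (le_trans (ler_normD _ _)); apply: lerD.
    apply: (le_trans (ler_normD _ _)); rewrite lerD2l normrM -[L]mul1r.
    by rewrite ler_pM.
  by apply: (le_trans q2); rewrite -[leRHS]mulr1 ler_wpM2l.
rewrite normrM -mulrA; apply: ler_pM => //.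
apply: (le_trans (ler_normD _ _)); rewrite lerD2l normrM -[K]mul1r ler_pM //.
Qed.

(** A kernel vector v equals - v (E - 1), so the sum of the norms of its entries
    is at most m e times itself. *)
Lemma unitmx_near1 (e : C) (E : 'M[C]_m) :
    (forall i j, `|(E - 1%:M) i j| <= e) -> m%:R * e < 1 -> E \in unitmx.
Proof.
move=> Ee me1; rewrite unitmxE unitfE; apply/negP => /det0P[v vN0 vE].
pose s := \sum_i `|v 0 i|.
have s0 : 0 <= s by rewrite sumr_ge0.
have vs i : `|v 0 i| <= e * s.
  have -> : v 0 i = - (v *m (E - 1%:M)) 0 i.
    by rewrite mulmxBr vE mulmx1 sub0r mxE opprK.
  rewrite normrN mxE mulr_sumr; apply: (le_trans (ler_norm_sum _ _ _)).
  by apply: ler_sum => k _; rewrite normrM mulrC ler_wpM2r.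
have : s <= m%:R * e * s.
  rewrite -mulrA -[m in m%:R]card_ord -sum1_card natr_sum mulr_suml.
  by apply: ler_sum => k _; rewrite mul1r.
have [s00|sN0] := eqVneq s 0; last first.
  by rewrite -ler_pdivrMr ?lt_def ?sN0 // divff // lt_geF.
move=> _; case/negP: vN0; apply/eqP/rowP => i; rewrite mxE; apply/eqP.
by rewrite -normr_le0 (le_trans (vs i)) // s00 mulr0.
Qed.

(** The exponential E of t A is a stabilizing matrix close to 1 + t A, and
    p vanishes at y E = y + t u with u close to yA. Dividing the Taylor
    expansion of p by t bounds the derivative along yA by a multiple of t. *)
Lemma tangent_of_stabilizer A (U : {vspace 'M[C]_m}) p y :
    (forall Q, Q \in U -> A *m Q + Q *m A^T \in U) ->
    (forall g, g \in unitmx -> (forall Q, Q \in U -> g *m Q *m g^T \in U) ->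
       p.@[(y *m g) 0] = 0) ->
  mdiff p y (y *m A) = 0.
Proof.
move=> AU pg.
have py : p.@[y 0] = 0.
  by rewrite -[y]mulmx1 pg ?unitmx1 // => Q; rewrite trmx1 mulmx1 mul1mx.
pose a := \sum_i \sum_j `|A i j|.
have Aa := norm_entry_le A : forall i j, `|A i j| <= a.
have a0 : 0 <= a by rewrite sumr_ge0 // => k _; rewrite sumr_ge0.
pose b := m%:R * a + 1; have b1 : 1 <= b by rewrite lerDr mulr_ge0.
have b0 : 0 < b by apply: lt_le_trans b1.
pose Y := \sum_i `|y 0 i|; have Y0 : 0 <= Y by rewrite sumr_ge0.
pose c2 := Y * (4 * b ^+ 2).
have c20 : 0 <= c2 by rewrite /c2 mulr_ge0 // mulr_ge0 ?ler0n // exprn_ge0 // ltW.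
pose c := \sum_i `|(y *m A) 0 i| + c2.
have c0 : 0 <= c by rewrite addr_ge0 ?sumr_ge0.
have [K K0 pK] := taylor_bound p y c0.
pose c3 := \sum_i `|(p^`M(i)).@[y 0]|.
have c30 : 0 <= c3 by rewrite sumr_ge0.
(* With t = 1 / (k 2^n), the bound r = t b on m |t A i j| is at most 1/8, and
   4 m r < 1, so that unitmx_near1 applies to E. *)
pose k := 8 * m.+1%:R * b; have k0 : 0 < k by rewrite !mulr_gt0 ?ltr0n.
apply: (@squeeze0 _ _ ((K + c2 * c3) / k)) => n.
have n0 : 0 < 2 ^+ n :> C by rewrite exprn_gt0.
pose t := (k * 2 ^+ n)^-1.
have t0 : 0 < t by rewrite invr_gt0 mulr_gt0.
have -> : (K + c2 * c3) / k / 2 ^+ n = (K + c2 * c3) * t.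
  by rewrite -mulrA; congr (_ * _); rewrite [RHS]invfM.
pose r := t * b; have r0 : 0 <= r by rewrite mulr_ge0 ?ltW.
have n1 : 1 <= 2 ^+ n :> C by rewrite exprn_ege1 ?ler1n.
have rE : r = (8 * m.+1%:R * 2 ^+ n)^-1.
  rewrite /r /t /k; field; apply/and3P; split; rewrite ?gt_eqF //.
  by rewrite addrC natr1 ltr0n.
have r8m : r <= (8 * m.+1%:R)^-1.
  by rewrite rE lef_pV2 ?posrE ?mulr_gt0 ?ltr0n // ler_peMr // mulr_ge0 ?ler0n.
have r8 : r <= 8^-1.
  apply: (le_trans r8m); rewrite lef_pV2 ?posrE ?mulr_gt0 ?ltr0n //.
  by rewrite ler_peMr ?ler0n // ler1n.
have r2 : r <= 2^-1.
  by apply: (le_trans r8); rewrite lef_pV2 ?posrE ?ltr0n // ler_nat.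
have t1 : t <= 1.
  rewrite invf_le1 ?mulr_gt0 // mulr_ege1 //.
  by rewrite /k mulr_ege1 // mulr_ege1 ?ler1n.
have Br i j : m%:R * `|(t *: A) i j| <= r.
  rewrite mxE normrM gtr0_norm // mulrCA /r ler_pM2l // /b.
  by apply: le_trans (_ : m%:R * a <= _); rewrite ?ler_wpM2l // lerDl.
have [E Eexp] := exp_exists r0 r2 Br.
have EU Q : Q \in U -> E *m Q *m E^T \in U.
  apply: (exp_conj_mem r0 r8 Br _ Eexp) => Q' Q'U.
  by rewrite linearZ /= -scalemxAl -scalemxAr -scalerDr memvZ ?AU.
have Eunit : E \in unitmx.
  apply: (@unitmx_near1 (4 * r)) => [i j|].
    have := Eexp 0%N i j; rewrite /expsum big_ord1 expterm0 expr1.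
    by move=> h; rewrite [(E - _) i j]mxE [X in _ + X]mxE.
  apply: le_lt_trans (_ : m%:R * (4 * (8 * m.+1%:R)^-1) < 1).
    by rewrite !ler_wpM2l ?ler0n.
  have -> : m%:R * (4 * (8 * m.+1%:R)^-1) = m%:R / (2 * m.+1%:R) :> C.
    by field; rewrite addrC natr1 pnatr_eq0.
  by rewrite ltr_pdivrMr ?mulr_gt0 ?ltr0n // mul1r -natrM ltr_nat mulSn ltn_addr.
have pE := pg E Eunit EU.
pose u := t^-1 *: (y *m E - y).
have yE : y *m E = y + t *: u.
  by rewrite /u scalerA divff ?gt_eqF // scale1r addrC subrK.
have du i : `|(u - y *m A) 0 i| <= t * c2.
  have -> : u - y *m A = t^-1 *: (y *m (E - expsum (t *: A) 1)).
    rewrite /u /expsum big_ord_recr big_ord1 /= expterm0.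
    have -> : expterm (t *: A) 1 = t *: A.
      by rewrite -[LHS]scale1r (exptermS _ 0) expterm0 mulmx1.
    rewrite !mulmxBr mulmxDr mulmx1 opprD addrA -scalemxAr [RHS]scalerBr.
    by rewrite scalerA mulVf ?gt_eqF // scale1r.
  have tV0 : 0 < t^-1 by rewrite invr_gt0.
  rewrite mxE normrM (gtr0_norm tV0) -(ler_pM2l t0) mulrA divff ?gt_eqF // mul1r.
  rewrite mxE; apply: (le_trans (ler_norm_sum _ _ _)).
  have -> : t * (t * c2) = Y * (4 * r ^+ 2) by rewrite /c2 /r; ring.
  rewrite mulr_suml; apply: ler_sum => j _; rewrite normrM ler_wpM2l //.
  by have := Eexp 1%N j i; rewrite !mxE.
have uc i : `|u 0 i| <= c.
  rewrite -(subrK (y *m A) u) addrC mxE; apply: (le_trans (ler_normD _ _)).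
  apply: lerD; first by rewrite (bigD1 i) //= lerDl sumr_ge0.
  by apply: (le_trans (du i)); rewrite ler_piMl.
have [_ pu] := pK t u (ltW t0) t1 uc.
rewrite -yE pE py subrr sub0r normrN normrM gtr0_norm // in pu.
have {}pu : `|mdiff p y u| <= K * t.
  by rewrite -(ler_pM2l t0); apply: (le_trans pu); rewrite expr2 mulrCA.
have -> : mdiff p y (y *m A) = mdiff p y u - mdiff p y (u - y *m A).
  by rewrite -{1}(subrK (y *m A) u) mdiffDr addrAC subrr add0r.
apply: (le_trans (ler_normB _ _)); rewrite mulrDl; apply: lerD => //.
apply: (le_trans (ler_norm_sum _ _ _)); rewrite mulrAC mulr_sumr.
by apply: ler_sum => i _; rewrite normrM mulrC ler_wpM2r // mulrC.
Qed.

End Integration.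

(** * Linear algebra of quadratic forms *)

(** A subspace of maximal dimension among those contained in P is all of P. *)
Lemma vspace_of_pred (F : fieldType) (V : vectType F) (P : V -> Prop) :
    P 0 -> (forall a u v, P u -> P v -> P (a *: u + v)) ->
  exists W : {vspace V}, forall v, v \in W <-> P v.
Proof.
move=> P0 PL; pose D d := `[< exists2 W : {vspace V}, \dim W = d &
  forall v, v \in W -> P v >].
have exD : exists d, D d.
  exists 0%N; apply/asboolP; exists 0%VS; rewrite ?dimv0 // => u.
  by move=> /vlineP[a ->]; rewrite scaler0.
have ubD d : D d -> (d <= \dim {:V})%N.
  by move=> /asboolP[W <- _]; apply/dimvS/subvf.
case: (ex_maxnP exD ubD) => d /asboolP[W dW WP] maxd.
exists W => u; split=> [/WP //|Pu].
have /maxd : D (\dim (<[u]> + W)).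
  apply/asboolP; exists (<[u]> + W)%VS => // w.
  by move=> /memv_addP[_ /vlineP[a ->] [w2 /WP Pw2 ->]]; apply: PL.
rewrite -dW => le_d.
have /eqP -> : W == (<[u]> + W)%VS by rewrite eqEdim addvSr le_d.
by rewrite -[u in u \in _]addr0 memv_add ?mem0v ?memv_line.
Qed.

(** If B is a matrix whose rows span W, the columns of its cokernel are
    orthogonal to W, hence to phi. *)
Lemma double_annihilator (F : fieldType) m (W : {vspace 'rV[F]_m}) (phi : 'rV[F]_m) :
    (forall v : 'rV[F]_m, (forall psi, psi \in W -> psi *m v^T = 0) ->
       phi *m v^T = 0) ->
  phi \in W.
Proof.
move=> phiW; pose B := \matrix_(l < \dim W) (vbasis W)`_l.
have : (phi <= B)%MS.
  rewrite submxE; apply/eqP/matrixP => i j; rewrite [RHS]mxE.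
  have : phi *m col j (cokermx B) = 0.
    rewrite -[col _ _]trmxK; apply: phiW => psi /coord_vbasis->.
    rewrite trmxK mulmx_suml big1 // => l _.
    have -> : (vbasis W)`_l = row l B by rewrite rowK.
    by rewrite colE -scalemxAl mulmxA -row_mul mulmx_coker row0 mul0mx scaler0.
  rewrite colE mulmxA -colE => /matrixP/(_ i 0).
  by rewrite [LHS]mxE [RHS]mxE.
case/submxP=> D ->; rewrite mulmx_sum_row memv_suml // => l _.
by rewrite rowK memvZ // vbasis_mem // mem_nth // size_tuple.
Qed.

Section Residue.
Variables (F : fieldType) (m : nat) (U : {vspace 'M[F]_m}).
Implicit Types X : 'M[F]_m.

(** The equations of U in the space of matrices. *)
Definition residue a b X : F := (X - projv U X) a b.

Lemma residueE a b X :
  residue a b X = \sum_k \sum_l residue a b (delta_mx k l) * X k l.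
Proof.
have rD : {morph residue a b : Y Z / Y + Z}.
  by move=> Y Z; rewrite /residue linearD opprD addrACA mxE.
have r0 : residue a b 0 = 0 by rewrite /residue linear0 subrr mxE.
rewrite {1}[X]matrix_sum_delta (big_morph _ rD r0); apply: eq_bigr => k _.
rewrite (big_morph _ rD r0); apply: eq_bigr => l _.
by rewrite {1}/residue linearZ -scalerBr mxE mulrC.
Qed.

Lemma residueP X : X \in U <-> forall a b, residue a b X = 0.
Proof.
split=> [XU a b|X0]; first by rewrite /residue projv_id // subrr mxE.
have /eqP : X - projv U X = 0 by apply/matrixP => a b; rewrite [RHS]mxE; apply: X0.
by rewrite subr_eq0 => /eqP->; apply: memv_proj.
Qed.

End Residue.

(** Matrices act on row vectors on the right, so g Q g^T is the matrix of the
    quadratic form Q composed with g. *)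
Definition form_stab (F : fieldType) m (U : {vspace 'M[F]_m}) (g : 'M[F]_m) : Prop :=
  g \in unitmx /\ forall Q, Q \in U -> g *m Q *m g^T \in U.

Section FormStab.
Variables (F : fieldType) (m : nat) (U : {vspace 'M[F]_m}).

Lemma form_stab1 : form_stab U 1%:M.
Proof. by split=> [|Q]; rewrite ?unitmx1 // trmx1 mulmx1 mul1mx. Qed.

Lemma form_stabM g h : form_stab U g -> form_stab U h -> form_stab U (g *m h).
Proof.
move=> [gu gU] [hu hU]; split; first by rewrite unitmx_mul gu.
by move=> Q /hU/gU; rewrite trmx_mul !mulmxA.
Qed.

(** Q |-> g Q g^T is an injective endomorphism of the finite dimensional space U,
    hence surjective. *)
Lemma form_stabV g : form_stab U g -> form_stab U (invmx g).
Proof.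
move=> [gu gU]; split; first by rewrite unitmx_inv.
pose f : 'End('M[F]_m) := linfun (mulmxr g^T \o mulmx g).
have fE Q : f Q = g *m Q *m g^T by rewrite lfunE.
have fK Q : invmx g *m f Q *m (invmx g)^T = Q.
  by rewrite fE !mulmxA mulVmx // mul1mx -mulmxA -trmx_mul mulVmx // trmx1 mulmx1.
have kerf : lker f == 0%VS.
  by apply/lker0P => Q1 Q2 e; rewrite -(fK Q1) e fK.
have fU : (f @: U)%VS = U.
  apply/eqP; rewrite eqEdim; apply/andP; split.
    by apply/subvP => _ /memv_imgP[Q /gU QU ->]; rewrite fE.
  by rewrite limg_dim_eq // (eqP kerf) capv0.
move=> Q; rewrite -{1}fU => /memv_imgP[Q' Q'U ->]; by rewrite fK.
Qed.

End FormStab.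

(** * Density and transitivity of orbits *)

Section Core.
Variables (R : realType) (m : nat).
Local Notation C := R[i].
Local Notation S := {mpoly C[m]}.
Variables (K : 'rV[C]_m -> Prop) (U : {vspace 'M[C]_m}).
Hypothesis KU : forall y : 'rV[C]_m, K y <-> forall Q, Q \in U -> y *m Q *m y^T = 0.
Hypothesis irrK : irreducible_cone K.

Let I (p : S) : Prop := forall y, K y -> p.@[y 0] = 0.

(* Every tangent vector at a nonzero point is the value of a linear vector field
   that is tangent to K everywhere and preserves U. *)
Hypothesis infinitesimal : forall x v : 'rV[C]_m, K x -> x <> 0 ->
  (forall p, I p -> mdiff p x v = 0) ->
  exists A : 'M[C]_m, [/\ forall Q, Q \in U -> A *m Q + Q *m A^T \in U,
    forall p y, I p -> K y -> mdiff p y (y *m A) = 0 & x *m A = v].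

Definition orbit_of (x y : 'rV[C]_m) : Prop :=
  exists2 g, form_stab U g & y = x *m g.

Lemma orbit_sub x y : K x -> orbit_of x y -> K y.
Proof.
move=> /KU Kx [g [_ gU] ->]; apply/KU => Q /gU QU.
by rewrite trmx_mul !mulmxA -[x *m g *m Q]mulmxA -(mulmxA x) Kx.
Qed.

Let ideal_vanishing (Y : 'rV[C]_m -> Prop) :
  ideal_pred (fun p : S => forall y, Y y -> p.@[y 0] = 0).
Proof.
split=> [y _|p q hp hq y Yy|c p hp y Yy]; first exact: meval0.
  by rewrite mevalD hp ?hq ?addr0.
by rewrite mevalM hp ?mulr0.
Qed.

(** The differentials at x of the elements of I form a subspace, and tangent
    vectors are by definition its annihilator. *)
Lemma conormal x (phi : 'rV[C]_m) :
    (forall v : 'rV[C]_m, (forall p, I p -> mdiff p x v = 0) -> phi *m v^T = 0) ->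
  exists2 p, I p & forall j, (p^`M(j)).@[x 0] = phi 0 j.
Proof.
move=> phiT; have [I0 ID IM] := ideal_vanishing K.
have [||W WP] := @vspace_of_pred _ 'rV[C]_m
  (fun psi => exists2 p, I p & forall j, (p^`M(j)).@[x 0] = psi 0 j).
- by exists 0 => // j; rewrite mderiv0 meval0 mxE.
- move=> a u v [p Ip pu] [q Iq qv]; exists (a%:MP * p + q).
    exact: ID (IM a%:MP p Ip) Iq.
  by move=> j; rewrite mderivD mevalD mderiv_mulC mevalM mevalC pu qv !mxE.
apply/WP; apply: double_annihilator => v vW; apply: phiT => p Ip.
have /vW/matrixP/(_ 0 0) : \row_j (p^`M(j)).@[x 0] \in W.
  by apply/WP; exists p => // j; rewrite mxE.
by rewrite !mxE => <-; apply: eq_bigr => j _; rewrite !mxE.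
Qed.

(** With l |-> b_l a basis of the tangent space T at x and A l a linear field of
    value b_l at x, the Euler field is the sum over l of h l * (y A_l), where
    h l is the l-th coordinate of the projection of y - x to T. Up to second
    order at x its i-th component is the i-th component of this projection,
    and it differs from y_i - x_i by a linear form that vanishes on T, which is
    the differential of an element of I. *)
Lemma orbit_dense x (p : S) : K x -> x <> 0 ->
  (forall y, orbit_of x y -> p.@[y 0] = 0) -> I p.
Proof.
move=> Kx xN0 Jp; pose J (q : S) := forall y, orbit_of x y -> q.@[y 0] = 0.
have iI : ideal_pred I := ideal_vanishing K.
have iJ : ideal_pred J := ideal_vanishing (orbit_of x).
have [I0 ID IM] := iI; have [J0 JD JM] := iJ.
have [||T TP] := @vspace_of_pred _ 'rV[C]_m (fun v => forall q, I q -> mdiff q x v = 0).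
- by move=> q _; rewrite -(scale0r (0 : 'rV[C]_m)) mdiffZr mul0r.
- by move=> a u v hu hv q Iq; rewrite mdiffDr mdiffZr hu ?hv // mulr0 addr0.
have /choice[A AP] : forall l : 'I_(\dim T), exists A : 'M[C]_m,
    [/\ forall Q, Q \in U -> A *m Q + Q *m A^T \in U,
    forall q y, I q -> K y -> mdiff q y (y *m A) = 0 & x *m A = (vbasis T)`_l].
  move=> l; apply: infinitesimal => //; apply/TP.
  by rewrite vbasis_mem // mem_nth // size_tuple.
pose eta l (v : 'rV[C]_m) := coord (vbasis T) l (projv T v).
pose xi l (q : S) : S := \sum_i q^`M(i) * \sum_j (A l j i) *: 'X_j.
have xiE l q (y : 'rV[C]_m) : (xi l q).@[y 0] = mdiff q y (y *m A l).
  rewrite raddf_sum; apply: eq_bigr => i _ /=; rewrite mevalM; congr (_ * _).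
  rewrite raddf_sum mxE; apply: eq_bigr => j _ /=.
  by rewrite mevalZ mevalXU mulrC.
pose h l : S := \sum_j eta l (delta_mx 0 j) *: centered x j.
pose F i : S := \sum_l h l * \sum_j (A l j i) *: 'X_j.
have DF q : \sum_i q^`M(i) * F i = \sum_l h l * xi l q.
  under eq_bigr do rewrite mulr_sumr.
  rewrite exchange_big; apply: eq_bigr => l _ /=; rewrite mulr_sumr.
  by apply: eq_bigr => i _; rewrite mulrCA.
have h1 l : ideal_pow (centered x) 1 (h l).
  apply: ideal_pred_sum => [|j _]; first exact: ideal_pow_ideal.
  by rewrite -mul_mpolyC mulrC; apply: ideal_pow_gen.
have etaE (v : 'rV[C]_m) : \sum_l eta l v *: (vbasis T)`_l = projv T v.
  by rewrite [RHS](coord_vbasis (memv_proj _ _)).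
have Euler i : exists2 g, ideal_pow (centered x) 2 g & I (F i - centered x i - g).
  have [m0 mD mM] := ideal_pow_ideal (centered x) 2.
  pose phi : 'rV[C]_m := \row_j (projv T (delta_mx 0 j) 0 i - (i == j)%:R).
  have [|f If fphi] := @conormal x phi.
    move=> v /TP vT; apply/matrixP => a b; rewrite !ord1 [RHS]mxE mxE.
    have -> : \sum_j phi 0 j * v^T j 0 = (projv T v - v) 0 i.
      rewrite {2}[v]row_sum_delta linear_sum mxE summxE.
      rewrite [in RHS]mxE [X in _ + X](_ : _ = - \sum_j v 0 j * (i == j)%:R); last first.
        rewrite (bigD1 i) //= eqxx mulr1 big1 ?addr0 // => j.
        by rewrite eq_sym => /negPf->; rewrite mulr0.
      rewrite -sumrB; apply: eq_bigr => j _; rewrite !mxE linearZ /= mxE.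
      by rewrite mulrBl ![_ * v 0 j]mulrC.
    by rewrite (projv_id vT) subrr mxE.
  have fx : f.@[x 0] = 0 by apply: If.
  pose q2 := \sum_l h l * \sum_j (A l j i) *: centered x j.
  exists (q2 - (f - (f.@[x 0])%:MP - linear_part x f)).
    apply: ideal_predB; [exact: ideal_pow_ideal | | exact: taylor2].
    apply: ideal_pred_sum => [|l _]; first exact: ideal_pow_ideal.
    apply: (@ideal_powM _ _ _ 1 1) => //.
    apply: ideal_pred_sum => [|j _]; first exact: ideal_pow_ideal.
    by rewrite -mul_mpolyC mulrC; apply: ideal_pow_gen.
  suff -> : F i - centered x i - (q2 - (f - (f.@[x 0])%:MP - linear_part x f)) = f by [].
  rewrite fx mpolyC0 subr0.
  have FE : F i = q2 + \sum_j (projv T (delta_mx 0 j) 0 i) *: centered x j.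
    have -> : \sum_j (projv T (delta_mx 0 j) 0 i) *: centered x j =
        \sum_l h l * (((vbasis T)`_l 0 i)%:MP).
      under [RHS]eq_bigr do rewrite mulr_suml.
      rewrite [RHS]exchange_big; apply: eq_bigr => j _ /=.
      rewrite -etaE summxE scaler_suml; apply: eq_bigr => l _.
      by rewrite mxE [RHS]mulrC mul_mpolyC scalerA [in RHS]mulrC.
    rewrite /q2 -big_split; apply: eq_bigr => l _ /=; rewrite -mulrDr; congr (_ * _).
    have [_ _ <-] := AP l; rewrite mxE raddf_sum -big_split; apply: eq_bigr => j _ /=.
    by rewrite /centered scalerBr -[_ *: _%:MP]mul_mpolyC -mpolyCM [x _ _ * _]mulrC subrK.
  have -> : linear_part x f = \sum_j (projv T (delta_mx 0 j) 0 i) *: centered x j -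
      centered x i.
    have -> : centered x i = \sum_j (i == j)%:R *: centered x j.
      rewrite (bigD1 i) //= eqxx scale1r big1 ?addr0 // => j.
      by rewrite eq_sym => /negPf->; rewrite scale0r.
    by rewrite -sumrB; apply: eq_bigr => j _; rewrite fphi mxE scalerBl.
  by rewrite FE; ring.
have xi_J l q : J q -> J (xi l q).
  move=> Jq y [g gU ->]; rewrite xiE; have [AU _ _] := AP l.
  apply: (tangent_of_stabilizer AU) => g' g'u g'U; apply: Jq.
  exists (g *m g'); last by rewrite mulmxA.
  exact: form_stabM gU (conj g'u g'U).
have xi_I l q : I q -> I (xi l q).
  by move=> Iq y Ky; rewrite xiE; have [_ + _] := AP l; apply.
have C0 : [pchar C] =i pred0 := pchar_num _.
have all_k k : exists2 g, ideal_pow (centered x) k g & I (p - g).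
  apply: (stable_sub_ideal_pow C0 (F := F) (J := J) iI) => //.
  - move=> q Jq; exists (fun j => \sum_l eta l (delta_mx 0 j) *: xi l q).
      move=> j; apply: ideal_pred_sum => // l _.
      by rewrite -mul_mpolyC; apply: JM; apply: xi_J.
    rewrite DF [X in I X](_ : _ = 0) //; apply/eqP; rewrite subr_eq0; apply/eqP.
    under eq_bigr do rewrite mulr_suml.
    rewrite exchange_big; apply: eq_bigr => j _ /=; rewrite mulr_sumr.
    by apply: eq_bigr => l _; rewrite -scalerAl scalerAr.
  - move=> q Iq; rewrite DF; apply: ideal_pred_sum => // l _.
    by apply: IM; apply: xi_I.
  - move=> q Jq; apply: ideal_pow1_of_eval; apply: Jq.
    by exists 1%:M; rewrite ?mulmx1 //; apply: form_stab1.
have noethS : noetherian S by apply/noetherian_mpoly/noetherian_field.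
have [c c1 Icp] := krull_intersection noethS iI all_k.
have [_ prime] := irrK; case: (prime _ _ Icp) => // /(_ x Kx) /eqP.
by rewrite mevalB meval1 (ideal_pow1_eval c1) subr0 oner_eq0.
Qed.

(** The orbit is the image of the group of stabilizing matrices, which is given by
    the equations residue = 0 and the inequation det <> 0. *)
Lemma orbit_definable x : qf_definable (orbit_of x).
Proof.
pose G : 'M[{mpoly C[m * m]}]_m := \matrix_(i, j) 'X_(mxvec_index i j).
pose toM (w : 'I_(m * m) -> C) : 'M[C]_m := map_mx (meval w) G.
have toM_surj g : exists w, toM w = g.
  exists (mxvec g 0); apply/matrixP => i j.
  by rewrite !mxE mevalXU mxvecE.
pose eqn (z : 'I_(\dim U) * ('I_m * 'I_m)) : {mpoly C[m * m]} :=
  \sum_k \sum_l residue U z.2.1 z.2.2 (delta_mx k l) *: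
    (G *m map_mx (@mpolyC (m * m) C) (vbasis U)`_(z.1) *m G^T) k l.
have eqnE z w : (eqn z).@[w] =
    residue U z.2.1 z.2.2 (toM w *m (vbasis U)`_(z.1) *m (toM w)^T).
  rewrite residueE raddf_sum; apply: eq_bigr => k _ /=.
  rewrite raddf_sum; apply: eq_bigr => l _ /=; rewrite mevalZ; congr (_ * _).
  have -> : toM w *m (vbasis U)`_(z.1) *m (toM w)^T =
      map_mx (meval w) (G *m map_mx (@mpolyC (m * m) C) (vbasis U)`_(z.1) *m G^T).
    rewrite !map_mxM map_trmx; congr (_ *m _ *m _).
    by apply/matrixP => i j; rewrite !mxE /= mevalC.
  by rewrite [RHS]mxE.
have [f qf fP] := qf_definable_image (@complex_acf_axiom R) (map eqn (enum setT))
  (\det G) (fun j => \sum_i x 0 i *: G i j).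
exists f => // y; rewrite -fP.
have yE w : (forall j, y 0 j = (\sum_i x 0 i *: G i j).@[w]) <-> y = x *m toM w.
  have e j : (\sum_i x 0 i *: G i j).@[w] = (x *m toM w) 0 j.
    rewrite raddf_sum mxE; apply: eq_bigr => i _ /=.
    by rewrite mevalZ [in RHS]mxE.
  split=> [yw|->] //; apply/rowP => j; by rewrite yw e.
have unitE w : (\det G).@[w] <> 0 <-> toM w \in unitmx.
  rewrite unitmxE unitfE /toM det_map_mx; split=> [/eqP //|/eqP //].
split=> [[g [gu gU] yg]|[w [sw hw yw]]].
  have [w wg] := toM_surj g; exists w; split.
  - move=> _ /mapP[z _ ->]; rewrite eqnE wg.
    have [zU _] := residueP U (g *m (vbasis U)`_(z.1) *m g^T); apply/zU/gU.
    by rewrite vbasis_mem // mem_nth // size_tuple.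
  - by apply/unitE; rewrite wg.
  - by apply/yE; rewrite wg.
exists (toM w); last exact/yE.
split; first exact/unitE.
move=> Q /coord_vbasis->; rewrite mulmx_sumr mulmx_suml memv_suml // => l _.
rewrite -scalemxAr -scalemxAl memvZ //; apply/residueP => a b.
by rewrite -(eqnE (l, (a, b))); apply: sw; apply: map_f; rewrite mem_enum inE.
Qed.

Lemma orbit_transitive x y : K x -> K y -> x <> 0 -> y <> 0 ->
  exists2 g, form_stab U g & x *m g = y.
Proof.
move=> Kx Ky xN0 yN0.
have [z [g gU zx] [h hU zy]] := @dense_definable_meet _ _ K (orbit_of x) (orbit_of y)
  irrK (fun z => @orbit_sub x z Kx) (fun z => @orbit_sub y z Ky)
  (orbit_definable x) (orbit_definable y)
  (fun p => @orbit_dense x p Kx xN0) (fun p => @orbit_dense y p Ky yN0).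
exists (g *m invmx h); first exact: form_stabM gU (form_stabV hU).
by rewrite mulmxA -zx zy -mulmxA mulmxV ?mulmx1 //; case: hU.
Qed.

End Core.

(** * Polynomial functions on vector spaces *)

Lemma poly_zero_everywhere (F : numDomainType) (p : {poly F}) :
  (forall s, p.[s] = 0) -> p = 0.
Proof.
move=> p0; apply/eqP; apply: contraT => pN0.
pose r := [seq (i%:R : F) | i <- iota 0 (size p)].
have : (size r < size p)%N.
  apply: max_poly_roots => //; first by apply/allP => s _; apply/eqP.
  by rewrite map_inj_uniq ?iota_uniq // => i j /eqP; rewrite eqr_nat => /eqP.
by rewrite size_map size_iota ltnn.
Qed.

Lemma meval_homog (F : comNzRingType) n d (p : {mpoly F[n]}) (s : F) (y : 'I_n -> F) :
  p \is d.-homog -> p.@[fun i => s * y i] = s ^+ d * p.@[y].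
Proof.
move=> /dhomogP hp; rewrite !mevalE mulr_sumr big_seq [RHS]big_seq.
apply: eq_bigr => a /hp ad; rewrite mulrCA; congr (_ * _).
have <- : (\sum_i a i)%N = d by rewrite -mdegE.
by rewrite -prodrXr -big_split; apply: eq_bigr => i _; rewrite exprMn.
Qed.

Section PolynomialFunctions.
Variable R : realType.
Local Notation C := R[i].
Implicit Types (V W : vectType C).

Definition polyfn W (f : W -> C) : Prop :=
  exists p : polyfun W, forall v, f v = peval p v.

Lemma crd_sum W (v : W) : v = \sum_i crd v i *: (vbasis {:W})`_i.
Proof. by rewrite {1}(coord_vbasis (memvf v)). Qed.

Lemma polyfn_linear W (f : W -> C) :
  (forall a u v, f (a *: u + v) = a * f u + f v) -> polyfn f.
Proof.
move=> fL; exists (\sum_(i < \dim {:W}) f (vbasis {:W})`_i *: 'X_i) => v.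
have f0 : f 0 = 0 by have := fL (-1) 0 0; rewrite scaler0 addr0 mulN1r addNr.
have fD : {morph f : u v / u + v} by move=> u w; have := fL 1 u w; rewrite scale1r mul1r.
rewrite {1}(crd_sum v) (big_morph f fD f0) /peval raddf_sum.
apply: eq_bigr => i _ /=; rewrite mevalZ mevalXU mulrC.
by have := fL (crd v i) (vbasis {:W})`_i 0; rewrite f0 !addr0.
Qed.

Lemma eq_polyfn W (f g : W -> C) : f =1 g -> polyfn f -> polyfn g.
Proof. by move=> fg [p fp]; exists p => v; rewrite -fg. Qed.

Lemma polyfn_const W c : polyfn (fun _ : W => c).
Proof. by exists c%:MP => v; rewrite /peval mevalC. Qed.

Lemma polyfnD W (f g : W -> C) : polyfn f -> polyfn g -> polyfn (fun v => f v + g v).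
Proof. by move=> [p fp] [q gq]; exists (p + q) => v; rewrite /peval mevalD fp gq. Qed.

Lemma polyfnM W (f g : W -> C) : polyfn f -> polyfn g -> polyfn (fun v => f v * g v).
Proof. by move=> [p fp] [q gq]; exists (p * q) => v; rewrite /peval mevalM fp gq. Qed.

Lemma polyfn_sum W (J : Type) (r : seq J) (P : pred J) (f : J -> W -> C) :
  (forall j, polyfn (f j)) -> polyfn (fun v => \sum_(j <- r | P j) f j v).
Proof.
move=> fP; elim: r => [|j r IH].
  by apply: (eq_polyfn _ (polyfn_const W 0)) => v; rewrite big_nil.
case Pj : (P j).
  by apply: (eq_polyfn _ (polyfnD (fP j) IH)) => v; rewrite big_cons Pj.
by apply: eq_polyfn IH => v; rewrite big_cons Pj.
Qed.

Lemma polyfn_prod W (J : Type) (r : seq J) (P : pred J) (f : J -> W -> C) :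
  (forall j, polyfn (f j)) -> polyfn (fun v => \prod_(j <- r | P j) f j v).
Proof.
move=> fP; elim: r => [|j r IH].
  by apply: (eq_polyfn _ (polyfn_const W 1)) => v; rewrite big_nil.
case Pj : (P j).
  by apply: (eq_polyfn _ (polyfnM (fP j) IH)) => v; rewrite big_cons Pj.
by apply: eq_polyfn IH => v; rewrite big_cons Pj.
Qed.

Lemma polyfn_det W n (A : W -> 'M[C]_n) :
  (forall i j, polyfn (fun v => A v i j)) -> polyfn (fun v => \det (A v)).
Proof.
move=> AP; apply: polyfn_sum => s; apply: polyfnM; first exact: polyfn_const.
exact: polyfn_prod.
Qed.

Lemma polyfn_adj W n (A : W -> 'M[C]_n) i j :
  (forall i j, polyfn (fun v => A v i j)) -> polyfn (fun v => (\adj (A v)) i j).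
Proof.
move=> AP; apply: (@eq_polyfn _ (fun v => cofactor (A v) j i)) => [v|].
  by rewrite mxE.
apply: polyfnM; first exact: polyfn_const.
apply: polyfn_det => k l.
by apply: eq_polyfn (AP (lift j k) (lift i l)) => v; rewrite !mxE.
Qed.

Lemma polyfn_mulmx W n p q (A : W -> 'M[C]_(n, p)) (B : W -> 'M[C]_(p, q)) i j :
    (forall i j, polyfn (fun v => A v i j)) -> (forall i j, polyfn (fun v => B v i j)) ->
  polyfn (fun v => (A v *m B v) i j).
Proof.
move=> AP BP; apply: (@eq_polyfn _ (fun v => \sum_k A v i k * B v k j)) => [v|].
  by rewrite mxE.
by apply: polyfn_sum => k; apply: polyfnM.
Qed.

Lemma polyfn_entry n p i j : polyfn (fun A : 'M[C]_(n, p) => A i j).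
Proof. by apply: polyfn_linear => a A B; rewrite !mxE. Qed.

Lemma polynomial_map_mx W n p (A : W -> 'M[C]_(n, p)) :
  (forall i j, polyfn (fun v => A v i j)) -> polynomial_map A.
Proof.
move=> AP k.
suff [q qP] : polyfn (fun v => crd (A v) k) by exists q.
have cL (a : C) (u v : 'M[C]_(n, p)) : crd (a *: u + v) k = a * crd u k + crd v k.
  by rewrite /crd linearP.
have c0 : crd (0 : 'M[C]_(n, p)) k = 0 by rewrite /crd linear0.
have cD : {morph (fun u : 'M[C]_(n, p) => crd u k) : u v / u + v}.
  by move=> u v; rewrite /crd linearD.
apply: (@eq_polyfn _ (fun v => \sum_i \sum_j A v i j * crd (delta_mx i j : 'M[C]_(n, p)) k)).
  move=> v; rewrite [in RHS](matrix_sum_delta (A v)) (big_morph (fun u => crd u k) cD c0).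
  apply: eq_bigr => i _; rewrite (big_morph (fun u => crd u k) cD c0).
  by apply: eq_bigr => j _; rewrite /crd linearZ.
by apply: polyfn_sum => i; apply: polyfn_sum => j; apply: polyfnM => //; apply: polyfn_const.
Qed.

Lemma crdZ W (s : C) (v : W) : crd (s *: v) =1 (fun i => s * crd v i).
Proof. by move=> i; rewrite /crd linearZ. Qed.

Lemma peval_homog W d (p : polyfun W) s v :
  p \is d.-homog -> peval p (s *: v) = s ^+ d * peval p v.
Proof. by move=> hp; rewrite /peval (meval_eq _ (crdZ s v)) (meval_homog _ _ hp). Qed.

Lemma peval_line W (p : polyfun W) (k : nat) (v : W) s : (msize p <= k)%N ->
  peval p (s *: v) = (\poly_(e < k) peval (pihomog mdeg e p) v).[s].
Proof.
move=> pk; rewrite {1}(pihomog_partitionE pk) /peval raddf_sum horner_poly.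
apply: eq_bigr => e _ /=; rewrite mulrC -(meval_homog _ _ (pihomogP mdeg e p)).
by apply: meval_eq; apply: crdZ.
Qed.

(** Comparing coefficients of s shows that f agrees with the homogeneous component
    of degree d of a polynomial that represents it. *)
Lemma polyfn_homog W d (f : W -> C) :
    polyfn f -> (forall s v, f (s *: v) = s ^+ d * f v) ->
  exists2 p : polyfun W, p \is d.-homog & forall v, f v = peval p v.
Proof.
move=> [p fp] fd; exists (pihomog mdeg d p); first exact: pihomogP.
move=> v; pose k := maxn (msize p) d.+1.
have : \poly_(e < k) peval (pihomog mdeg e p) v - (f v)%:P * 'X^d = 0.
  apply: poly_zero_everywhere => s.
  rewrite hornerD hornerN hornerM hornerC hornerXn -peval_line ?leq_maxl //.
  by rewrite -fp fd mulrC subrr.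
move/(congr1 (fun q : {poly C} => q`_d)); rewrite coef0 coefB coef_poly.
rewrite leq_max ltnSn orbT coefCM coefXn eqxx mulr1 => /eqP.
by rewrite subr_eq0 => /eqP.
Qed.

End PolynomialFunctions.

(** * Points of projective space *)

Section ProjectivePoints.
Variable R : realType.
Local Notation C := R[i].
Implicit Types (V W : vectType C).

Definition proj_rep W (L : proj W) : W := vpick (val L).

Lemma proj_rep_neq0 W (L : proj W) : proj_rep L != 0.
Proof. by rewrite vpick0 -dimv_eq0 (eqP (valP L)). Qed.

Lemma proj_rep_mem W (L : proj W) : proj_rep L \in val L.
Proof. exact: memv_pick. Qed.

Lemma val_proj_line W (L : proj W) w : w \in val L -> w != 0 -> val L = <[w]>%VS.
Proof.
move=> wL w0; apply/eqP; rewrite eq_sym eqEdim -memvE wL.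
by rewrite dim_vline w0 (eqP (valP L)).
Qed.

Lemma proj_eq W (L L' : proj W) w : w \in val L -> w \in val L' -> w != 0 -> L = L'.
Proof.
by move=> wL wL' w0; apply: val_inj; rewrite (val_proj_line wL) ?(val_proj_line wL').
Qed.

Lemma mem_proj_repZ W (L : proj W) w : w \in val L -> exists a, w = a *: proj_rep L.
Proof. by rewrite (val_proj_line (proj_rep_mem L) (proj_rep_neq0 L)) => /vlineP. Qed.

(** The line spanned by w, or L0 when w = 0. *)
Definition proj_line W (L0 : proj W) (w : W) : proj W := insubd L0 <[w]>%VS.

Lemma proj_line_mem W (L0 : proj W) w a : w != 0 -> a *: w \in val (proj_line L0 w).
Proof.
move=> w0; rewrite insubdK; first by rewrite memvZ // memv_line.
by rewrite unfold_in /= dim_vline w0.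
Qed.

End ProjectivePoints.

Local Open Scope classical_set_scope.
Local Open Scope ring_scope.

(** * The stabilizer of a space of quadratic forms as an algebraic group *)

Section StabilizerGroup.
Variable R : realType.
Local Notation C := R[i].
Variables (m : nat) (m_gt0 : (0 < m)%N) (U : {vspace 'M[C]_m}).
Local Notation M := 'M[C]_m.

Lemma unit_neq0 (g : M) : g \in unitmx -> g != 0.
Proof.
case: m m_gt0 g => // k _ g; apply: contraTneq => ->.
by rewrite unitmxE det0 unitr0.
Qed.

Lemma form_stabZ (c : C) (g : M) : c != 0 -> form_stab U g -> form_stab U (c *: g).
Proof.
move=> c0 [gu gU]; split; first by rewrite unitmxZ ?unitfE.
by move=> Q /gU QU; rewrite linearZ /= -scalemxAr -!scalemxAl !memvZ.
Qed.

Lemma form_stab_adj (g : M) : form_stab U g -> form_stab U (\adj g).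
Proof.
move=> gS; have [gu _] := gS.
have -> : \adj g = \det g *: invmx g.
  by rewrite /invmx gu scalerA divff ?scale1r // -unitfE -unitmxE.
by apply: form_stabZ; [rewrite -unitfE -unitmxE | apply: form_stabV].
Qed.

Definition stab_set : set (proj M) := [set L | form_stab U (proj_rep L)].

Lemma stab_setP (L : proj M) g :
  g \in val L -> g != 0 -> stab_set L <-> form_stab U g.
Proof.
move=> /mem_proj_repZ[a ga] g0.
have a0 : a != 0 by apply: contraNneq g0 => a0; rewrite ga a0 scale0r.
rewrite /stab_set /= ga; split=> [|gS]; first exact: form_stabZ.
by rewrite -[proj_rep L]scale1r -(mulVf a0) -scalerA; apply: form_stabZ; rewrite ?invr_eq0.
Qed.

Lemma one_proof : \dim <[1%:M : M]>%VS == 1%N.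
Proof. by rewrite dim_vline unit_neq0 // unitmx1. Qed.

Definition stab_one : proj M := Sub <[1%:M : M]>%VS one_proof.

Lemma stab_one_mem : 1%:M \in val stab_one.
Proof. by rewrite /= memv_line. Qed.

(** The factors are exchanged because matrices act on the right. *)
Definition stab_mul (L1 L2 : proj M) : proj M :=
  proj_line stab_one (proj_rep L2 *m proj_rep L1).
Definition stab_inv (L : proj M) : proj M := proj_line stab_one (\adj (proj_rep L)).

Lemma stab_mul_mem L1 L2 g h : stab_set L1 -> stab_set L2 ->
  g \in val L1 -> h \in val L2 -> h *m g \in val (stab_mul L1 L2).
Proof.
move=> [u1 _] [u2 _] /mem_proj_repZ[a ->] /mem_proj_repZ[b ->].
rewrite -scalemxAr -scalemxAl scalerA; apply: proj_line_mem.
by rewrite unit_neq0 // unitmx_mul u2.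
Qed.

Lemma adjZ (s : C) (g : M) : \adj (s *: g) = s ^+ m.-1 *: \adj g.
Proof.
apply/matrixP => i j; rewrite !mxE /cofactor.
have -> : row' j (col' i (s *: g)) = s *: row' j (col' i g).
  by apply/matrixP => k l; rewrite !mxE.
by rewrite detZ mulrCA.
Qed.

Lemma stab_inv_mem L g : stab_set L -> g \in val L -> \adj g \in val (stab_inv L).
Proof.
move=> LS /mem_proj_repZ[a ->]; rewrite adjZ; apply: proj_line_mem.
by apply: unit_neq0; have [] := form_stab_adj LS.
Qed.

Lemma stab_mul_in g h : stab_set g -> stab_set h -> stab_set (stab_mul g h).
Proof.
move=> gS hS; have S := form_stabM hS gS.
apply/(stab_setP (stab_mul_mem gS hS (proj_rep_mem g) (proj_rep_mem h))) => //.
by apply: unit_neq0; case: S.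
Qed.

Lemma stab_inv_in g : stab_set g -> stab_set (stab_inv g).
Proof.
move=> gS; have S := form_stab_adj gS.
apply/(stab_setP (stab_inv_mem gS (proj_rep_mem g))) => //.
by apply: unit_neq0; case: S.
Qed.

Lemma stab_one_in : stab_set stab_one.
Proof.
apply/(stab_setP stab_one_mem); last exact: form_stab1.
by rewrite unit_neq0 // unitmx1.
Qed.

Lemma stab_mulA g h k : stab_set g -> stab_set h -> stab_set k ->
  stab_mul g (stab_mul h k) = stab_mul (stab_mul g h) k.
Proof.
move=> gS hS kS; apply: (@proj_eq _ _ _ _ (proj_rep k *m proj_rep h *m proj_rep g)).
- exact: stab_mul_mem gS (stab_mul_in hS kS) (proj_rep_mem g)
    (stab_mul_mem hS kS (proj_rep_mem h) (proj_rep_mem k)).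
- rewrite -mulmxA.
  exact: stab_mul_mem (stab_mul_in gS hS) kS
    (stab_mul_mem gS hS (proj_rep_mem g) (proj_rep_mem h)) (proj_rep_mem k).
- move: gS hS kS => [gu _] [hu _] [ku _].
  by apply: unit_neq0; rewrite !unitmx_mul ku hu gu.
Qed.

Lemma stab_mul1g g : stab_set g -> stab_mul stab_one g = g.
Proof.
move=> gS; apply: (@proj_eq _ _ _ _ (proj_rep g)); [|exact: proj_rep_mem | exact: proj_rep_neq0].
rewrite -[X in X \in _]mulmx1.
exact: stab_mul_mem stab_one_in gS stab_one_mem (proj_rep_mem g).
Qed.

Lemma stab_mulVg g : stab_set g -> stab_mul (stab_inv g) g = stab_one.
Proof.
move=> gS; apply: (@proj_eq _ _ _ _ (proj_rep g *m \adj (proj_rep g))).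
- exact: stab_mul_mem (stab_inv_in gS) gS (stab_inv_mem gS (proj_rep_mem g))
    (proj_rep_mem g).
- by rewrite mul_mx_adj -scalemx1 memvZ // stab_one_mem.
- have [gu _] := gS; have [au _] := form_stab_adj gS.
  by apply: unit_neq0; rewrite unitmx_mul gu au.
Qed.

(** The conditions g Q g^T \in U are quadratic in g, and invertibility is the
    nonvanishing of the form det of degree m. *)
Lemma stab_variety : proj_locally_closed stab_set.
Proof.
pose good (p : polyfun M) := (exists d, p \is d.-homog) /\
  forall g, (forall Q, Q \in U -> g *m Q *m g^T \in U) -> peval p g = 0.
pose bad (p : polyfun M) := p \is m.-homog /\ forall g, peval p g = \det g.
exists [set L : proj M | forall p, good p -> forall v, v \in val L -> peval p v = 0].
exists [set L : proj M | forall p, bad p -> forall v, v \in val L -> peval p v = 0].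
split; [by exists good; split=> // p [] | by exists bad; split=> // p [hp _]; exists m |].
have [d dh dE] := @polyfn_homog R M m (fun g => \det g)
  (polyfn_det (@polyfn_entry R m m)) (fun s g => detZ s g).
apply/seteqP; split=> L /=.
  move=> [gu gU]; split=> [p [[e hp] pU] v|/(_ d)].
    by move=> /mem_proj_repZ[a ->]; rewrite (peval_homog _ _ hp) pU ?mulr0.
  move/(_ _ (proj_rep L) (proj_rep_mem L)) => bd.
  move: gu; rewrite unitmxE unitfE dE bd ?eqxx //.
  by split=> // g; rewrite -dE.
move=> [Lgood Lbad]; split.
  rewrite unitmxE unitfE; apply/eqP => detL; apply: Lbad => p [hp pdet] v.
  by move=> /mem_proj_repZ[a ->]; rewrite pdet detZ detL mulr0.
move=> Q QU; set X := _ *m _.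
apply/residueP => i j; pose f (g : M) := residue U i j (g *m Q *m g^T).
have fP : polyfn f.
  apply: (@eq_polyfn _ _ (fun g => \sum_k \sum_l
      residue U i j (delta_mx k l) * (g *m Q *m g^T) k l)) => [g|].
    by rewrite /f residueE.
  apply: polyfn_sum => k; apply: polyfn_sum => l; apply: polyfnM; first exact: polyfn_const.
  apply: polyfn_mulmx => a b; last first.
    by apply: (eq_polyfn _ (@polyfn_entry R m m b a)) => g; rewrite mxE.
  apply: polyfn_mulmx => c e; first exact: polyfn_entry.
  exact: polyfn_const.
have [|p hp pE] := polyfn_homog (d := 2) fP.
  move=> s g; rewrite /f linearZ /= -scalemxAr -!scalemxAl scalerA -expr2.
  rewrite residueE [X in _ = _ * X]residueE mulr_sumr; apply: eq_bigr => k _.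
  by rewrite mulr_sumr; apply: eq_bigr => l _; rewrite [in LHS]mxE mulrCA.
rewrite -[LHS]/(f (proj_rep L)) pE; apply: Lgood (proj_rep_mem L); split; first by exists 2%N.
by move=> g gU; rewrite -pE /f; have [zU _] := residueP U (g *m Q *m g^T); apply/zU/gU.
Qed.

Lemma stab_mul_regular : regular_map2 stab_set stab_set stab_mul.
Proof.
move=> a b aS bS; exists (fun uv : M * M => uv.2 *m uv.1), 1%N, 1%N; split.
- apply: polynomial_map_mx => i j.
  by apply: polyfn_mulmx => k l; apply: polyfn_linear => c u v; rewrite /= !mxE.
- by move=> s t u v /=; rewrite -scalemxAl -scalemxAr scalerA mulrC.
- exists (proj_rep a), (proj_rep b); split; [exact: proj_rep_mem | exact: proj_rep_mem |].
  apply/eqP; rewrite unit_neq0 // unitmx_mul.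
  by case: aS => ->; case: bS => ->.
- by move=> a' b' a'S b'S u v ua vb; apply: stab_mul_mem.
Qed.

(** The adjugate represents the inverse up to a scalar, without denominators. *)
Lemma stab_inv_regular : regular_map stab_set stab_inv.
Proof.
move=> a aS; exists (fun u : M => \adj u), m.-1; split.
- apply: polynomial_map_mx => i j; apply: polyfn_adj => k l; exact: polyfn_entry.
- exact: adjZ.
- exists (proj_rep a); first exact: proj_rep_mem.
  by apply/eqP/unit_neq0; have [] := form_stab_adj aS.
- by move=> a' a'S u ua; apply: stab_inv_mem.
Qed.

Definition stab_group : algebraic_group R :=
  AlgebraicGroup stab_variety stab_one_in stab_mul_in stab_inv_in stab_mulA
    stab_mul1g stab_mulVg stab_mul_regular stab_inv_regular.

End StabilizerGroup.

(** * Quadratic forms and their matrices *)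

Section Quad.
Variables (F : comNzRingType) (m : nat).
Implicit Types (Q : 'M[F]_m) (y v : 'rV[F]_m).

Definition quad Q : {mpoly F[m]} := \sum_i \sum_j Q i j *: ('X_i * 'X_j).

Lemma meval_quad Q y : (quad Q).@[y 0] = (y *m Q *m y^T) 0 0.
Proof.
rewrite /quad raddf_sum mxE /=.
under [RHS]eq_bigr do rewrite !mxE mulr_suml.
rewrite [RHS]exchange_big; apply: eq_bigr => i _ /=; rewrite raddf_sum.
apply: eq_bigr => j _ /=; rewrite mevalZ mevalM !mevalXU; ring.
Qed.

Lemma mdiff_quad Q y v : Q^T = Q -> mdiff (quad Q) y v = 2 * (y *m Q *m v^T) 0 0.
Proof.
move=> Qsym.
have -> : mdiff (quad Q) y v = (v *m Q *m y^T) 0 0 + (y *m Q *m v^T) 0 0.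
  rewrite /quad (big_morph (fun p => mdiff p y v) (id1 := 0) (op1 := +%R)); last first.
  - by rewrite -(mpolyC0 m F) mdiffC.
  - by move=> p q; apply: mdiffD.
  rewrite !mxE.
  under [X in _ = X + _]eq_bigr do rewrite !mxE mulr_suml.
  under [X in _ = _ + X]eq_bigr do rewrite !mxE mulr_suml.
  rewrite [X in _ = X + _]exchange_big [X in _ = _ + X]exchange_big -big_split.
  apply: eq_bigr => i _ /=; rewrite -big_split.
  rewrite (big_morph (fun p => mdiff p y v) (id1 := 0) (op1 := +%R)); last first.
  - by rewrite -(mpolyC0 m F) mdiffC.
  - by move=> p q; apply: mdiffD.
  apply: eq_bigr => j _ /=; rewrite -mul_mpolyC !mdiffM mdiffC !mdiffX.
  by rewrite mevalC !mevalXU; ring.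
have -> : (v *m Q *m y^T) 0 0 = (y *m Q *m v^T) 0 0.
  have -> : v *m Q *m y^T = (y *m Q *m v^T)^T by rewrite !trmx_mul trmxK Qsym mulmxA.
  by rewrite mxE.
by rewrite mulr_natl mulr2n.
Qed.

End Quad.

Lemma quadP (F : numFieldType) m (q : {mpoly F[m]}) :
  q \is 2.-homog -> exists2 Q : 'M[F]_m, Q^T = Q & q = quad Q.
Proof.
have qD (Q Q' : 'M[F]_m) : quad (Q + Q') = quad Q + quad Q'.
  rewrite /quad -big_split; apply: eq_bigr => i _ /=; rewrite -big_split.
  by apply: eq_bigr => j _ /=; rewrite mxE scalerDl.
have qZ a (Q : 'M[F]_m) : quad (a *: Q) = a *: quad Q.
  rewrite /quad scaler_sumr; apply: eq_bigr => i _ /=; rewrite scaler_sumr.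
  by apply: eq_bigr => j _ /=; rewrite mxE scalerA.
have qdelta i j : quad (delta_mx i j : 'M[F]_m) = 'X_i * 'X_j.
  rewrite /quad (bigD1 i) //= (bigD1 j) //= mxE !eqxx scale1r.
  rewrite [X in _ + X + _]big1 ?addr0 => [|l lj]; last first.
    by rewrite mxE (negPf lj) andbF scale0r.
  rewrite big1 ?addr0 // => k ki; rewrite big1 // => l _.
  by rewrite mxE (negPf ki) scale0r.
move=> /dhomogP hq; rewrite (mpolyE q) big_seq.
apply: (big_ind (fun p => exists2 Q : 'M[F]_m, Q^T = Q & p = quad Q)).
- exists 0; rewrite ?trmx0 // /quad big1 // => i _; rewrite big1 // => j _.
  by rewrite mxE scale0r.
- move=> p1 p2 [Q1 s1 ->] [Q2 s2 ->]; exists (Q1 + Q2); last by rewrite qD.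
  by rewrite linearD /= s1 s2.
move=> a /hq a2.
have [i [j _ ->]] : exists i, exists2 j, True & a = (U_(i) + U_(j))%MM.
  have [i ai] : exists i, a i != 0%N.
    apply/existsP; rewrite -negb_forall; apply/negP => /forallP a0.
    move: a2; rewrite /= mdegE big1 // => i _; exact/eqP.
  have le_ia : (U_(i) <= a)%MM by rewrite lep1mP.
  have : mdeg (a - U_(i))%MM = 1%N.
    have : mdeg (a - U_(i) + U_(i))%MM = 2%N by rewrite submK.
    by rewrite mdegD mdeg1 addn1 => -[].
  move/eqP/mdeg1P=> [j /eqP ja]; exists i, j => //.
  by rewrite -ja addmC submK.
exists (q@_(U_(i) + U_(j)) *: (2^-1 *: (delta_mx i j + delta_mx j i))).
  rewrite [LHS]linearZ; congr (_ *: _); rewrite [LHS]linearZ; congr (_ *: _).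
  by rewrite [LHS]linearD /= !trmx_delta addrC.
rewrite !qZ qD !qdelta mpolyXD [X in _ + X]mulrC -mulr2n -scaler_nat.
by rewrite [2^-1 *: _]scalerA mulVf ?scale1r // pnatr_eq0.
Qed.

(** * The affine cone in coordinates *)

Section Coordinates.
Variables (R : realType) (V : vectType R[i]).
Local Notation C := R[i].
Local Notation m := (\dim {:V}).

Definition rowv (v : V) : 'rV[C]_m := \row_i crd v i.
Definition unrow (y : 'rV[C]_m) : V := \sum_i y 0 i *: (vbasis {:V})`_i.

Lemma rowvK : cancel rowv unrow.
Proof. by move=> v; rewrite [RHS]crd_sum; apply: eq_bigr => i _; rewrite mxE. Qed.

Lemma unrowK : cancel unrow rowv.
Proof.
move=> y; apply/rowP => i; rewrite mxE /crd coord_sum_free //.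
exact: basis_free (vbasisP _).
Qed.

Lemma rowvZD a u v : rowv (a *: u + v) = a *: rowv u + rowv v.
Proof. by apply/rowP => i; rewrite !mxE /crd linearP. Qed.

Lemma rowvZ a u : rowv (a *: u) = a *: rowv u.
Proof. by apply/rowP => i; rewrite !mxE /crd linearZ. Qed.

Lemma rowv0 : rowv 0 = 0.
Proof. by apply/rowP => i; rewrite !mxE /crd linear0. Qed.

Lemma rowv_eq0 v : rowv v = 0 -> v = 0.
Proof. by move=> v0; rewrite -(rowvK v) v0 -rowv0 rowvK. Qed.

Lemma unrowZ a y : unrow (a *: y) = a *: unrow y.
Proof. by apply: (can_inj rowvK); rewrite rowvZ !unrowK. Qed.

Lemma peval_rowv (p : polyfun V) v : peval p v = p.@[rowv v 0].
Proof. by apply: meval_eq => i; rewrite mxE. Qed.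

Lemma pdiff_rowv (p : polyfun V) x v : pdiff p x v = mdiff p (rowv x) (rowv v).
Proof.
apply: eq_bigr => i _; rewrite mxE; congr (_ * _).
by apply: meval_eq => j; rewrite mxE.
Qed.

Variable X : set (proj V).

Definition row_cone (y : 'rV[C]_m) : Prop := affine_cone X (unrow y).

Lemma affine_cone_row v : affine_cone X v <-> row_cone (rowv v).
Proof. by rewrite /row_cone rowvK. Qed.

Lemma affine_coneP (L : proj V) (v : V) : v \in val L -> v != 0 -> affine_cone X v <-> X L.
Proof.
move=> vL v0; split=> [[L' XL' vL']|XL]; last by exists L.
by rewrite (proj_eq vL vL' v0).
Qed.

Lemma homogeneous_idealP (p : polyfun V) :
  homogeneous_ideal X p <-> forall y, row_cone y -> p.@[y 0] = 0.
Proof.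
split=> [pX y Ky|pK v /affine_cone_row Kv]; last by rewrite peval_rowv pK.
by rewrite -[y]unrowK -peval_rowv pX.
Qed.

Lemma affine_coneZ a v : affine_cone X v -> affine_cone X (a *: v).
Proof. by case=> L XL vL; exists L => //; apply: memvZ. Qed.

(** The hypothesis only concerns homogeneous polynomials. If p and q do not vanish
    on the cone, neither do some homogeneous components of them, and these are
    both nonzero at some u of the cone. On the line through u, p and q
    are nonzero polynomials in one variable, so their product is not zero. *)
Lemma row_cone_irreducible :
  irreducible (@proj_closed R V) X -> irreducible_cone row_cone.
Proof.
move=> [[L0 XL0] irrX]; split.
  by exists 0; exists L0 => //; rewrite -rowv0 rowvK mem0v.
pose zeros (p : polyfun V) : set (proj V) :=
  [set L : proj V | forall v, v \in val L -> peval p v = 0].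
have zeros_closed d (p : polyfun V) : p \is d.-homog -> proj_closed (zeros p).
  move=> hp; exists [set p]; split=> [_ ->|]; first by exists d.
  by apply/seteqP; split=> L /= h => [_ ->|]; last exact: h.
have homog_prime d e (p q : polyfun V) v w : p \is d.-homog -> q \is e.-homog ->
    affine_cone X v -> affine_cone X w -> peval p v != 0 -> peval q w != 0 ->
    exists2 u, affine_cone X u & peval p u * peval q u != 0.
  move=> hp hq [L XL vL] [L' XL' wL'] pv qw; apply: contrapT => noU.
  have [|pX|qX] := irrX (zeros p) (zeros q) (zeros_closed d p hp) (zeros_closed e q hq).
  - move=> M XM.
    have [pq0|pq0] := eqVneq (peval p (proj_rep M) * peval q (proj_rep M)) 0; last first.
      by case: noU; exists (proj_rep M) => //; exists M => //; apply: proj_rep_mem.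
    move/eqP: pq0; rewrite mulf_eq0 => /orP[/eqP pM|/eqP qM]; [left|right] => u.
      by move=> /mem_proj_repZ[a ->]; rewrite (peval_homog _ _ hp) pM mulr0.
    by move=> /mem_proj_repZ[a ->]; rewrite (peval_homog _ _ hq) qM mulr0.
  - by move: pv; rewrite (pX L XL v vL) eqxx.
  - by move: qw; rewrite (qX L' XL' w wL') eqxx.
have component (p : polyfun V) (y : 'rV[C]_m) : p.@[y 0] != 0 ->
    exists d, peval (pihomog mdeg d p) (unrow y) != 0.
  move=> py; apply: contrapT => no; case/negP: py; apply/eqP.
  rewrite -[y]unrowK -peval_rowv -[unrow y]scale1r (peval_line _ _ (leqnn _)).
  rewrite horner_poly big1 // => e _.
  have [->|eN0] := eqVneq (peval (pihomog mdeg e p) (unrow y)) 0; first by rewrite mul0r.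
  by case: no; exists e.
move=> p q pq; apply: contrapT => /not_orP[/existsNP[y /not_implyP[Ky /eqP py]]
  /existsNP[z /not_implyP[Kz /eqP qz]]].
have [d pd] := component p y py; have [e qe] := component q z qz.
have [u Xu pqu] := homog_prime d e _ _ _ _ (pihomogP mdeg d p) (pihomogP mdeg e q)
  Ky Kz pd qe.

have PN0 (r : polyfun V) (f : nat) : peval (pihomog mdeg f r) u != 0 ->
    \poly_(i < maxn (msize r) f.+1) peval (pihomog mdeg i r) u != 0.
  apply: contraNneq => /(congr1 (fun g : {poly C} => g`_f)).
  by rewrite coef_poly coef0 leq_max ltnSn orbT => ->.
move: pqu; rewrite mulf_eq0 => /norP[/PN0 Pp /PN0 Qq].
have /eqP := mulf_neq0 Pp Qq; apply; apply: poly_zero_everywhere => s.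
rewrite hornerM -!peval_line ?leq_maxl // !peval_rowv -mevalM.
by apply: pq; rewrite -affine_cone_row; apply: affine_coneZ.
Qed.

End Coordinates.

(** * The action on the projective variety *)

Section Action.
Variables (R : realType) (V : vectType R[i]).
Local Notation C := R[i].
Local Notation m := (\dim {:V}).
Variables (X : set (proj V)) (U : {vspace 'M[C]_m}) (m_gt0 : (0 < m)%N).
Hypothesis KU : forall y : 'rV[C]_m,
  row_cone X y <-> forall Q, Q \in U -> y *m Q *m y^T = 0.
Hypothesis trans : forall x y : 'rV[C]_m, row_cone X x -> row_cone X y ->
  x <> 0 -> y <> 0 -> exists2 g, form_stab U g & x *m g = y.

Definition stab_act (L : proj 'M[C]_m) (x : proj V) : proj V :=
  proj_line x (unrow (rowv (proj_rep x) *m proj_rep L)).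

Lemma act_neq0 (g : 'M[C]_m) (v : V) : g \in unitmx -> v != 0 -> unrow (rowv v *m g) != 0.
Proof.
move=> gu; apply: contraNneq => /(congr1 (@rowv R V)); rewrite unrowK rowv0 => vg.
by apply/eqP/rowv_eq0; rewrite -[rowv v](mulmxK gu) vg mul0mx.
Qed.

Lemma stab_act_mem L (x : proj V) g (v : V) : stab_set U L -> g \in val L -> v \in val x ->
  unrow (rowv v *m g) \in val (stab_act L x).
Proof.
move=> [gu _] /mem_proj_repZ[a ->] /mem_proj_repZ[b ->].
rewrite rowvZ -scalemxAr -scalemxAl scalerA unrowZ; apply: proj_line_mem.
by apply: act_neq0; rewrite ?proj_rep_neq0.
Qed.

Lemma stab_homogeneous : homogeneous_space X.
Proof.
exists (stab_group m_gt0 U), stab_act; split; first split.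
- move=> L x LG Xx; have LS : stab_set U L := LG; have [gu gU] := LS.
  have v0 := act_neq0 gu (proj_rep_neq0 x).
  apply/(affine_coneP X (stab_act_mem LS (proj_rep_mem L) (proj_rep_mem x)) v0).
  have : row_cone X (rowv (proj_rep x)).
    by rewrite -affine_cone_row; exists x => //; apply: proj_rep_mem.
  move=> /KU Kx; apply/KU => Q /gU QU.
  by rewrite trmx_mul !mulmxA; have := Kx _ QU; rewrite !mulmxA.
- move=> x Xx.
  apply: (@proj_eq _ _ _ _ (proj_rep x)); [|exact: proj_rep_mem | exact: proj_rep_neq0].
  rewrite -[X in X \in _]rowvK -[rowv _]mulmx1; apply: stab_act_mem; last exact: proj_rep_mem.
    exact: (stab_one_in m_gt0 U).
  exact: stab_one_mem.
- move=> g h x gG hG Xx; have gS : stab_set U g := gG; have hS : stab_set U h := hG.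
  apply: (@proj_eq _ _ _ _ (unrow (rowv (proj_rep x) *m (proj_rep h *m proj_rep g)))).
  + apply: stab_act_mem; last exact: proj_rep_mem; first exact: stab_mul_in.
    exact: (stab_mul_mem m_gt0 gS hS (proj_rep_mem g) (proj_rep_mem h)).
  + rewrite mulmxA -[rowv (proj_rep x) *m proj_rep h]unrowK; apply: stab_act_mem => //.
      exact: proj_rep_mem.
    by apply: stab_act_mem => //; apply: proj_rep_mem.
  + apply: act_neq0; last exact: proj_rep_neq0.
    by case: gS => gu _; case: hS => hu _; rewrite unitmx_mul hu.
- move=> L x LG Xx; have LS : stab_set U L := LG.
  exists (fun uv : 'M[C]_m * V => unrow (rowv uv.2 *m uv.1)), 1%N, 1%N; split.
  + move=> k; have [p pP] : polyfn (fun uv : 'M[C]_m * V => (rowv uv.2 *m uv.1) 0 k).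
      apply: polyfn_mulmx => i j; apply: polyfn_linear => c u v /=.
        by rewrite rowvZD !mxE.
      by rewrite !mxE.
    exists p => v; rewrite -pP.
    by rewrite -[in RHS](unrowK (rowv v.2 *m v.1)) mxE.
  + move=> s t u v /=.
    by rewrite rowvZ -scalemxAr -scalemxAl scalerA unrowZ.
  + exists (proj_rep L), (proj_rep x); split; [exact: proj_rep_mem | exact: proj_rep_mem |].
    by apply/eqP/act_neq0; rewrite ?proj_rep_neq0 //; case: LS.
  + move=> L' x' LG' Xx' u v uL vx; have LS' : stab_set U L' := LG'.
    by apply: stab_act_mem.
move=> x y Xx Xy.
have row_neq0 (z : proj V) : rowv (proj_rep z) <> 0.
  by move/rowv_eq0/eqP; apply/negP/proj_rep_neq0.
have row_in z : X z -> row_cone X (rowv (proj_rep z)).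
  by move=> Xz; rewrite -affine_cone_row; exists z => //; apply: proj_rep_mem.
have [g gS xgy] := trans (row_in x Xx) (row_in y Xy) (row_neq0 x) (row_neq0 y).
have g0 : g != 0 by apply: (unit_neq0 m_gt0); case: gS.
pose L := proj_line (stab_one R m_gt0) g.
have gL : g \in val L by rewrite -[g]scale1r; apply: proj_line_mem.
have LS : stab_set U L by apply/(stab_setP U gL g0).
exists L => //.
apply: (@proj_eq _ _ _ _ (proj_rep y)); [|exact: proj_rep_mem | exact: proj_rep_neq0].
by rewrite -[proj_rep y]rowvK -xgy; apply: stab_act_mem => //; apply: proj_rep_mem.
Qed.

End Action.

(** * Hamiltonian vector fields on a legendrian cone *)

Section Legendrian.
Variables (R : realType) (V : vectType R[i]).
Local Notation C := R[i].
Local Notation m := (\dim {:V}).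
Variables (omega : {skew_symmetric V}) (omega_symplectic : is_psymplectic omega).

Lemma omegaC u v : omega u v = - omega v u.
Proof. by rewrite hermC /= expr1 mulN1r. Qed.

Lemma omegavv u : omega u u = 0.
Proof.
have /eqP := omegaC u u; rewrite -subr_eq0 opprK -mulr2n mulrn_eq0 /=.
by move=> /eqP.
Qed.

Definition gram : 'M[C]_m := \matrix_(i, j) omega (vbasis {:V})`_i (vbasis {:V})`_j.

Lemma omegaE u v : omega u v = (rowv u *m gram *m (rowv v)^T) 0 0.
Proof.
have lin_sum (w : V) (c : 'I_m -> C) (b : 'I_m -> V) :
    omega w (\sum_i c i *: b i) = \sum_i c i * omega w (b i).
  by rewrite linear_sum; apply: eq_bigr => i _; rewrite linearZ.
rewrite {1}[v]crd_sum lin_sum mxE; apply: eq_bigr => j _.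
rewrite omegaC {1}[u]crd_sum lin_sum !mxE -sumrN mulr_sumr mulr_suml.
apply: eq_bigr => i _; rewrite !mxE [omega _ (vbasis _)`_i]omegaC !mulrN opprK.
by ring.
Qed.

Lemma gram_unit : gram \in unitmx.
Proof.
have [/eqP nondeg _ _] := omega_symplectic.
rewrite unitmxE unitfE; apply/negP => /det0P[y yN0 yg].
have : unrow y \in orthov omega fullv.
  by apply/mem_orthovP => v _; rewrite omegaE unrowK yg mul0mx mxE.
rewrite nondeg memv0 => /eqP y0; case/negP: yN0.
by rewrite -[y]unrowK y0 rowv0.
Qed.

Variables (X : set (proj V)) (X_closed : proj_closed X) (X_neq0 : exists L, X L).
Hypotheses (X_smooth : smooth_variety X) (X_legendrian : legendrian omega X).
Hypothesis X_quadrics : generated_by_quadrics X.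
Local Notation K := (row_cone X).

Let I (p : polyfun V) : Prop := forall y, K y -> p.@[y 0] = 0.

Lemma quadric_space : exists U : {vspace 'M[C]_m}, forall Q, Q \in U <->
  Q^T = Q /\ forall y, K y -> y *m Q *m y^T = 0.
Proof.
apply: vspace_of_pred.
  by split=> [|y _]; rewrite ?trmx0 // mulmx0 mul0mx.
move=> a P Q [Psym PK] [Qsym QK]; split=> [|y Ky].
  by rewrite linearP /= Psym Qsym.
by rewrite mulmxDr mulmxDl -scalemxAr -scalemxAl PK ?QK // scaler0 addr0.
Qed.

Lemma quadric_in (U : {vspace 'M[C]_m}) Q :
    (forall Q, Q \in U <-> Q^T = Q /\ forall y, K y -> y *m Q *m y^T = 0) ->
  Q^T = Q -> I (quad Q) -> Q \in U.
Proof.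
move=> UP Qsym QI; apply/UP; split=> // y Ky; apply/matrixP => i j.
by rewrite !ord1 [RHS]mxE -meval_quad; apply: QI.
Qed.

(** A point where U vanishes is a zero of the whole ideal, since quadrics generate
    it, and X is closed. *)
Lemma cone_cut_by_quadrics (U : {vspace 'M[C]_m}) :
    (forall Q, Q \in U <-> Q^T = Q /\ forall y, K y -> y *m Q *m y^T = 0) ->
  forall y, K y <-> forall Q, Q \in U -> y *m Q *m y^T = 0.
Proof.
move=> UP y; split=> [Ky Q /UP[_ ->]//|yU].
have Iy p : I p -> p.@[y 0] = 0.
  move=> /(homogeneous_idealP X p)/X_quadrics[k [a [q [qI2 ->]]]].
  rewrite raddf_sum big1 // => i _ /=; rewrite mevalM.
  have [/homogeneous_idealP qI qh] := qI2 i; have [Q Qsym qQ] := quadP qh.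
  by rewrite qQ meval_quad yU ?mxE ?mulr0 //; apply: (quadric_in UP); rewrite // -qQ.
have [y0|yN0] := eqVneq (unrow y) 0.
  by have [L XL] := X_neq0; exists L; rewrite // y0 mem0v.
have dimy : \dim <[unrow y]>%VS == 1%N by rewrite dim_vline yN0.
exists (Sub <[unrow y]>%VS dimy); last by rewrite /= memv_line.
have [S [Shom XS]] := X_closed; rewrite XS /= => p Sp v /vlineP[c ->].
have [d hp] := Shom p Sp; rewrite (peval_homog _ _ hp).
suff -> : peval p (unrow y) = 0 by rewrite mulr0.
rewrite peval_rowv unrowK; apply: Iy; apply/homogeneous_idealP => w [L].
by rewrite XS /= => /(_ p Sp) + wL; apply.
Qed.

(** The field y |-> y (hamiltonian Q) is dual under omega to the differential
    2 y Q of the quadratic form of Q; see [hamiltonianE]. *)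
Definition hamiltonian (Q : 'M[C]_m) : 'M[C]_m := 2 *: (Q *m invmx gram).

Lemma hamiltonianE Q y v : Q^T = Q ->
  omega (unrow (y *m hamiltonian Q)) v = mdiff (quad Q) y (rowv v).
Proof.
move=> Qsym; rewrite omegaE unrowK (mdiff_quad _ _ Qsym) /hamiltonian.
rewrite -scalemxAr -!scalemxAl mxE; congr (_ * _).
by rewrite mulmxA mulmxKV ?gram_unit.
Qed.

Lemma mem_tangent x v : v \in tangent_space (affine_cone X) x <->
  forall p, I p -> mdiff p (rowv x) (rowv v) = 0.
Proof.
rewrite tangent_spaceP; split=> h p hp; last first.
  by rewrite pdiff_rowv h //; apply/homogeneous_idealP.
by rewrite -pdiff_rowv; apply: h; apply/homogeneous_idealP.
Qed.

(** The value z of the field at y is orthogonal to the tangent space T, because the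
    quadratic form vanishes on K; so T + <z> is isotropic and equals T. *)
Lemma hamiltonian_tangent Q y : Q^T = Q -> I (quad Q) -> K y ->
  forall p, I p -> mdiff p y (y *m hamiltonian Q) = 0.
Proof.
move=> Qsym QI Ky p Ip; have [y0|yN0] := eqVneq (unrow y) 0.
  by rewrite -(unrowK y) y0 rowv0 mul0mx -(scale0r (0 : 'rV[C]_m)) mdiffZr mul0r.
have sy : cone_smooth X (unrow y) by apply: X_smooth; split=> //=; apply/eqP.
have [Tiso Tmax] := X_legendrian sy.
set T := tangent_space _ _ in Tiso Tmax; set z := unrow (y *m hamiltonian Q).
have zT w : w \in T -> omega z w = 0.
  move=> /mem_tangent wT; rewrite hamiltonianE //.
  by rewrite -{1}[y]unrowK; apply: wT.
have TzT : (T + <[z]>)%VS = T.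
  apply: Tmax; last exact: addvSl.
  move=> _ _ /memv_addP[u uT [_ /vlineP[a ->] ->]] /memv_addP[w wT [_ /vlineP[b ->] ->]].
  rewrite linearD linearZ /= omegaC [omega _ z]omegaC !linearD !linearZ /=.
  rewrite (Tiso _ _ wT uT) omegavv (zT _ uT).
  by rewrite [omega w z]omegaC zT //; ring.
have : z \in T by rewrite -TzT; apply: (subvP (addvSr T <[z]>)); apply: memv_line.
by move/mem_tangent => /(_ p Ip); rewrite !unrowK.
Qed.

(** The linear form omega(v, -) vanishes on the tangent space at x, so it is the
    differential at x of some f in I. Write f as a combination of quadrics of
    I with coefficients a i: at x the differential only involves the values
    (a i)(x), so f may be replaced by a quadratic form. *)
Lemma tangent_hamiltonian x v : K x -> x <> 0 ->
    (forall p, I p -> mdiff p x v = 0) ->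
  exists2 Q : 'M[C]_m, Q^T = Q /\ I (quad Q) & x *m hamiltonian Q = v.
Proof.
move=> Kx xN0 vT.
have sx : cone_smooth X (unrow x).
  by apply: X_smooth; split=> //= x0; apply: xN0; rewrite -[x]unrowK x0 rowv0.
have [Tiso _] := X_legendrian sx.
have vT' : unrow v \in tangent_space (affine_cone X) (unrow x).
  by apply/mem_tangent => p Ip; rewrite !unrowK vT.
have [f If fv] := @conormal R m K x (v *m gram) (fun w wT => ltac:(
  apply/matrixP => i j; rewrite !ord1 [RHS]mxE -[v]unrowK -[w]unrowK -omegaE;
  apply: Tiso => //; apply/mem_tangent => p Ip; rewrite !unrowK; exact: wT)).
have [k [a [q [qI2 fE]]]] := X_quadrics (proj2 (homogeneous_idealP X f) If).
have /choice[Q QP] : forall i, exists Q : 'M[C]_m, [/\ Q^T = Q, q i = quad Q & I (quad Q)].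
  move=> i; have [/homogeneous_idealP qI qh] := qI2 i; have [Q Qsym qQ] := quadP qh.
  by exists Q; rewrite -qQ.
pose Q0 := \sum_i (a i).@[x 0] *: Q i.
have Q0sym : Q0^T = Q0.
  rewrite /Q0 raddf_sum; apply: eq_bigr => i _; rewrite [LHS]linearZ /=.
  by have [-> _ _] := QP i.
have grad w : mdiff f x w = 2 * (x *m Q0 *m w^T) 0 0.
  rewrite fE (big_morph (fun p => mdiff p x w) (id1 := 0) (op1 := +%R)); last first.
  - by rewrite -(mpolyC0 m C) mdiffC.
  - by move=> p r; apply: mdiffD.
  rewrite /Q0 mulmx_sumr mulmx_suml summxE mulr_sumr; apply: eq_bigr => i _.
  have [Qsym -> QI] := QP i; rewrite mdiffM (QI x Kx) mulr0 add0r (mdiff_quad _ _ Qsym).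
  by rewrite -scalemxAr -scalemxAl [in RHS]mxE mulrCA.
exists Q0; first split=> // y Ky.
  rewrite meval_quad /Q0 mulmx_sumr mulmx_suml summxE big1 // => i _.
  have [_ _ QI] := QP i.
  by rewrite -scalemxAr -scalemxAl mxE -meval_quad QI ?mulr0.
rewrite /hamiltonian -scalemxAr mulmxA scalemxAl.
suff -> : 2 *: (x *m Q0) = v *m gram by rewrite mulmxK ?gram_unit.
apply/rowP => j; rewrite -fv.
have := grad (delta_mx 0 j); rewrite trmx_delta -colE !mxE => <-.
rewrite /mdiff (bigD1 j) //= mxE !eqxx mulr1 big1 ?addr0 // => i ij.
by rewrite mxE (negPf ij) andbF mulr0.
Qed.

End Legendrian.

Theorem theorem6p9 (R : realType) (n : nat) (V : vectType R[i])
    (dimV : \dim {:V} = (2 * n)%N)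
    (omega : {skew_symmetric V}) (omega_symplectic : is_psymplectic omega)
    (X : set (proj V))
    (X_closed : proj_closed X)
    (X_smooth : smooth_variety X)
    (X_irreducible : irreducible (@proj_closed R V) X)
    (X_legendrian : legendrian omega X)
    (X_quadrics : generated_by_quadrics X) :
  homogeneous_space X.
Proof.
have [[L0 XL0] _] := X_irreducible.
have m_gt0 : (0 < \dim {:V})%N.
  by rewrite -(eqP (valP L0)) dimvS // subvf.
have [U UP] := quadric_space X.
have KU := cone_cut_by_quadrics X_closed (ex_intro _ L0 XL0) X_quadrics UP.
apply: (stab_homogeneous m_gt0 KU) => x y Kx Ky xN0 yN0.
apply: (orbit_transitive KU (row_cone_irreducible X_irreducible)) => // {x y Kx Ky xN0 yN0}.
move=> x v Kx xN0 vT.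
have [Q [Qsym QI] xQ] := tangent_hamiltonian omega_symplectic X_smooth X_legendrian
  X_quadrics Kx xN0 vT.
have tangent := hamiltonian_tangent omega_symplectic X_smooth X_legendrian Qsym QI.
exists (hamiltonian omega Q); split=> // [Q' /UP[Q'sym Q'K]|p y Ip Ky]; last exact: tangent.
(* A Q' + Q' A^T is the matrix of the derivative along A of the quadratic form of
   Q', and this derivative vanishes on K. *)
set A := hamiltonian omega Q; apply/UP; split=> [|y Ky].
  by rewrite linearD /= !trmx_mul trmxK Q'sym addrC.
have QI' z : row_cone X z -> (quad Q').@[z 0] = 0.
  by move=> Kz; rewrite meval_quad Q'K // mxE.
have := tangent y Ky _ QI'; rewrite (mdiff_quad _ _ Q'sym) -/A => /eqP.
rewrite mulf_eq0 pnatr_eq0 /= => /eqP yQA.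
have half : y *m Q' *m (y *m A)^T = 0.
  by apply/matrixP => i j; rewrite !ord1 yQA mxE.
rewrite mulmxDr mulmxDl.
have -> : y *m (Q' *m A^T) *m y^T = y *m Q' *m (y *m A)^T by rewrite trmx_mul !mulmxA.
have -> : y *m (A *m Q') *m y^T = (y *m Q' *m (y *m A)^T)^T.
  by rewrite !trmx_mul !trmxK Q'sym !mulmxA.
by rewrite half trmx0 addr0.
Qed.
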